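(* Let $n\ge1$, $\delta>0$ and $\beta<n+2$. Let $S\in\mathbb{R}$, $\mathbf b\in\mathcal H^S(\mathbf T^n)$, and for $t\ge0$ define $$\mathbf U(t)=\widehat{\mathbf b}_0\frac{t^2}{2}+\sum_{0\ne k\in\mathbb{Z}^n}\left[\cos(\sqrt{-M_k}\,t)-I\right]M_k^{-1}\widehat{\mathbf b}_ke^{ik\cdot x}.$$ Then: 1. if $\beta<n$, then $\mathbf U\in C^\infty([0,\infty),\mathcal H^q(\mathbf T^n))$ for any $q\le S$; 2. if $\beta=n$, then $\mathbf U\in C^\infty([0,\infty),\mathcal H^q(\mathbf T^n))$ for any $q<S$; 3. if $\beta>n$, then $\mathbf U\in C^{p+1}([0,\infty),\mathcal H^q(\mathbf T^n))$ for any $q\in\mathbb{R}$ and any positive integer $p$ satisfying $$q-S+(p-1)\frac{\beta-n}{2}\le0.$$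
   Context: Torus and spaces: $\mathbf T^n=\prod_{i=1}^n[0,2\pi]$ with periodic identification; a periodic vector distribution $\mathbf g$ is written $\mathbf g=\sum_{k\in\mathbb{Z}^n}\widehat{\mathbf g}_k e^{ik\cdot x}$ with Fourier coefficients $\widehat{\mathbf g}_k\in\mathbb{C}^n$. For $q\in\mathbb{R}$, $\mathcal H^q(\mathbf T^n)$ is the space of periodic vector distributions with $\|\mathbf g\|^2_{\mathcal H^q}=\sum_k(1+\|k\|^2)^q\|\widehat{\mathbf g}_k\|^2<\infty$. The derivative of a map $\mathbf U:[0,\infty)\to\mathcal H^q(\mathbf T^n)$ is $\mathbf U'(t)=\lim_{h\to0}\frac{\mathbf U(t+h)-\mathbf U(t)}{h}$, the limit taken in the $\mathcal H^q$ norm (one-sided at $t=0$). $C^p([0,\infty),\mathcal H^q(\mathbf T^n))$ denotes the maps $[0,\infty)\to\mathcal H^q(\mathbf T^n)$ that are $p$ times differentiable in this sense; $C^\infty$ means this for every $p$. Multipliers: with ${}_pF_q(a_1,\dots,a_p;b_1,\dots,b_q;x)=\sum_{m\ge0}\frac{(a_1)_m\cdots(a_p)_m}{(b_1)_m\cdots(b_q)_m}\frac{x^m}{m!}$, where $(a)_m=a(a+1)\cdots(a+m-1)$, set for $\nu\in\mathbb{R}^n$ $$\lambda_1(\nu)=-\|\nu\|^2\Big(3\mu\,{}_3F_4\big(1,\tfrac52,\tfrac{n+2-\beta}{2};2,\tfrac32,\tfrac{n+4}{2},\tfrac{n+4-\beta}{2};-\tfrac14\|\nu\|^2\delta^2\big)+(\lambda^*-\mu)\,{}_1F_2\big(\tfrac{n+2-\beta}{2};\tfrac{n+2}{2},\tfrac{n+4-\beta}{2};-\tfrac14\|\nu\|^2\delta^2\big)^2\Big),$$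 $$\lambda_2(\nu)=-\mu\|\nu\|^2\,{}_2F_3\big(1,\tfrac{n+2-\beta}{2};2,\tfrac{n+4}{2},\tfrac{n+4-\beta}{2};-\tfrac14\|\nu\|^2\delta^2\big).$$ For $k\in\mathbb{Z}^n\setminus\{0\}$, $M_k$ is the real symmetric $n\times n$ matrix with $M_kk=\lambda_1(k)k$ and $M_kw=\lambda_2(k)w$ for $w\perp k$ (the Fourier multiplier of the linear state-based peridynamic operator). $\sqrt{-M_k}$ and $\cos(\sqrt{-M_k}t)$ are defined by functional calculus: same eigenvectors, with eigenvalues $\sqrt{-\lambda_i(k)}$ and $\cos(\sqrt{-\lambda_i(k)}t)$. $I$ is the identity matrix. Standing assumption: the Lamé parameters satisfy $\mu>0$ and $\lambda^*\in\mathbb{R}$ is such that $\lambda_1(\nu)<0$ for all $\nu\ne0$ (and $\lambda_2(\nu)<0$ for all $\nu\neq0$). *)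

(* Defs.v *)
From HB Require Import structures.
From mathcomp Require Import all_boot all_order all_algebra.
From mathcomp Require Import all_classical all_reals all_analysis.
From mathcomp Require Import complex.

Set Implicit Arguments.
Unset Strict Implicit.
Unset Printing Implicit Defensive.

Import Order.TTheory GRing.Theory Num.Theory.
Import numFieldNormedType.Exports.

Local Open Scope classical_set_scope.
Local Open Scope complex_scope.
Local Open Scope ring_scope.

(* The library norm on matrices is the sup norm, hence explicit Euclidean
   norms on R^n and C^n. *)
Definition sqnorm (R : realType) (n : nat) (v : 'cV[R]_n) : R :=
  \sum_(i < n) v i 0 ^+ 2.

Definition sqnormC (R : realType) (n : nat) (v : 'cV[R[i]]_n) : R :=
  \sum_(i < n) (complex.Re (v i 0) ^+ 2 + complex.Im (v i 0) ^+ 2).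

Definition intvec (R : realType) (n : nat) (k : 'cV[int]_n) : 'cV[R]_n :=
  \col_i (k i 0)%:~R.

(* A periodic vector distribution g = sum_k g_k e^{ik.x} on T^n is represented
   by its family of Fourier coefficients. The families coming from
   distributions are those of polynomial growth, which is automatic as soon as
   some norm [Hnorm q g] below is finite. *)
Definition fourier (R : realType) (n : nat) : Type :=
  'cV[int]_n -> 'cV[R[i]]_n.

Definition Hsqnorm (R : realType) (n : nat) (q : R) (g : fourier R n) : \bar R :=
  \esum_(k in [set: 'cV[int]_n])
    ((1 + sqnorm (intvec R k)) `^ q * sqnormC (g k))%:E.

Definition Hnorm (R : realType) (n : nat) (q : R) (g : fourier R n) : \bar R :=
  (Hsqnorm q g `^ (2^-1)%R)%E.

Definition Hspace (R : realType) (n : nat) (q : R) : set (fourier R n) :=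
  [set g | (Hsqnorm q g < +oo)%E].

(* Maps [0, oo) -> H^q are represented by maps on R of which only the values at
   t >= 0 matter. *)

Definition diffquot (R : realType) (n : nat) (U : R -> fourier R n) (t h : R) :
    fourier R n :=
  fun k => h^-1%:C *: (U (t + h) k - U t k).

(* The restriction t + h >= 0 makes the limit one-sided at t = 0. The norm is
   extended-real valued, so no junk value arises outside H^q. *)
Definition Hderiv (R : realType) (n : nat) (q : R) (U V : R -> fourier R n) :
    Prop :=
  forall t : R, 0 <= t ->
    Hnorm q (fun k => diffquot U t h k - V t k)
      @[h --> within [set h | 0 <= t + h] 0^'] --> 0%E.

(* p times differentiable from [0, oo) to H^q; no continuity of the p-th
   derivative is required. *)
Fixpoint Cp (R : realType) (n : nat) (q : R) (p : nat) (U : R -> fourier R n) :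
    Prop :=
  (forall t : R, 0 <= t -> Hspace q (U t)) /\
  match p with
  | 0%N => True
  | p'.+1 => exists V, Hderiv q U V /\ Cp q p' V
  end.

Definition Cinfty (R : realType) (n : nat) (q : R) (U : R -> fourier R n) :
    Prop :=
  forall p, Cp q p U.

Definition pochhammer (R : realType) (a : R) (m : nat) : R :=
  \prod_(i < m) (a + i%:R).

Definition hyperg (R : realType) (a b : seq R) (x : R) : R :=
  limn (series (fun m =>
    (\prod_(c <- a) pochhammer c m) / (\prod_(c <- b) pochhammer c m)
    * (x ^+ m / m`!%:R))).

(* lam is the Lame parameter lambda^*. *)
Definition lambda1 (R : realType) (n : nat) (mu lam delta beta : R)
    (nu : 'cV[R]_n) : R :=
  - sqnorm nu *
  (3 * mu *
     hyperg [:: 1; 5 / 2; (n%:R + 2 - beta) / 2]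
            [:: 2; 3 / 2; (n%:R + 4) / 2; (n%:R + 4 - beta) / 2]
            (- (4^-1) * sqnorm nu * delta ^+ 2)
   + (lam - mu) *
     hyperg [:: (n%:R + 2 - beta) / 2]
            [:: (n%:R + 2) / 2; (n%:R + 4 - beta) / 2]
            (- (4^-1) * sqnorm nu * delta ^+ 2) ^+ 2).

Definition lambda2 (R : realType) (n : nat) (mu delta beta : R)
    (nu : 'cV[R]_n) : R :=
  - mu * sqnorm nu *
  hyperg [:: 1; (n%:R + 2 - beta) / 2]
         [:: 2; (n%:R + 4) / 2; (n%:R + 4 - beta) / 2]
         (- (4^-1) * sqnorm nu * delta ^+ 2).

(* Orthogonal projection onto the line spanned by v <> 0. *)
Definition lineproj (R : realType) (n : nat) (v : 'cV[R]_n) : 'M[R]_n :=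
  (sqnorm v)^-1 *: (v *m v^T).

(* The matrix acting as the scalar a on v and as the scalar c on the orthogonal
   complement of v (v <> 0); see [axialP]. *)
Definition axial (R : realType) (n : nat) (v : 'cV[R]_n) (a c : R) : 'M[R]_n :=
  a *: lineproj v + c *: (1%:M - lineproj v).

Definition Mk (R : realType) (n : nat) (mu lam delta beta : R)
    (k : 'cV[int]_n) : 'M[R]_n :=
  axial (intvec R k) (lambda1 mu lam delta beta (intvec R k))
                     (lambda2 mu delta beta (intvec R k)).

(* f(M_k) in the sense of the functional calculus; see [fMk_eigen]. *)
Definition fMk (R : realType) (n : nat) (mu lam delta beta : R) (f : R -> R)
    (k : 'cV[int]_n) : 'M[R]_n :=
  axial (intvec R k) (f (lambda1 mu lam delta beta (intvec R k)))
                     (f (lambda2 mu delta beta (intvec R k))).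

Definition cos_sqrtNMk (R : realType) (n : nat) (mu lam delta beta t : R)
    (k : 'cV[int]_n) : 'M[R]_n :=
  fMk mu lam delta beta (fun x => cos (Num.sqrt (- x) * t)) k.

Definition toC (R : realType) (n : nat) (A : 'M[R]_n) : 'M[R[i]]_n :=
  map_mx (fun x => x%:C) A.

Definition Usol (R : realType) (n : nat) (mu lam delta beta : R)
    (b : fourier R n) (t : R) : fourier R n :=
  fun k =>
    if k == 0 then (t ^+ 2 / 2)%:C *: b 0
    else toC ((cos_sqrtNMk mu lam delta beta t k - 1%:M)
                *m invmx (Mk mu lam delta beta k)) *m b k.

Lemma sqnorm_eq0 (R : realType) (n : nat) (v : 'cV[R]_n) :
  (sqnorm v == 0) = (v == 0).
Proof.
rewrite /sqnorm psumr_eq0; last by move=> i _; exact: sqr_ge0.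
apply/allP/eqP => [h|-> i _]; last by rewrite mxE expr0n/= eqxx.
apply/matrixP => i j; rewrite ord1 mxE; apply/eqP.
by have := h i (mem_index_enum i); rewrite sqrf_eq0.
Qed.

Lemma intvec_eq0 (R : realType) (n : nat) (k : 'cV[int]_n) :
  (intvec R k == 0) = (k == 0).
Proof.
apply/eqP/eqP => [/matrixP h|->]; last by apply/matrixP => i j; rewrite !mxE.
apply/matrixP => i j; rewrite ord1 mxE; apply/eqP.
by have /eqP := h i 0; rewrite !mxE intr_eq0.
Qed.

Lemma mul_tr_self (R : realType) (n : nat) (v : 'cV[R]_n) :
  v^T *m v = (sqnorm v)%:M.
Proof.
apply/matrixP => i j; rewrite !ord1 !mxE mulr1n.
by apply: eq_bigr => l _; rewrite mxE expr2.
Qed.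

Lemma lineproj_self (R : realType) (n : nat) (v : 'cV[R]_n) :
  v != 0 -> lineproj v *m v = v.
Proof.
move=> v0; rewrite /lineproj -scalemxAl -mulmxA mul_tr_self mul_mx_scalar.
by rewrite scalerA mulVf ?scale1r// sqnorm_eq0.
Qed.

Lemma lineproj_orth (R : realType) (n : nat) (v w : 'cV[R]_n) :
  v^T *m w = 0 -> lineproj v *m w = 0.
Proof.
by move=> vw; rewrite /lineproj -scalemxAl -mulmxA vw mulmx0 scaler0.
Qed.

Lemma lineproj_tr (R : realType) (n : nat) (v : 'cV[R]_n) :
  (lineproj v)^T = lineproj v.
Proof. by rewrite /lineproj linearZ /= trmx_mul trmxK. Qed.

Lemma axial_tr (R : realType) (n : nat) (v : 'cV[R]_n) (a c : R) :
  (axial v a c)^T = axial v a c.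
Proof.
have tE (A B : 'M[R]_n) : (a *: A + c *: (B - A))^T = a *: A^T + c *: (B^T - A^T).
  by apply/matrixP => i j; rewrite !mxE.
by rewrite /axial tE lineproj_tr trmx1.
Qed.

Lemma axial_mul (R : realType) (n : nat) (v w : 'cV[R]_n) (a c : R) :
  axial v a c *m w = a *: (lineproj v *m w) + c *: (w - lineproj v *m w).
Proof.
by rewrite /axial mulmxDl -[(a *: _) *m _]scalemxAl -[(c *: _) *m _]scalemxAl
           mulmxBl mul1mx.
Qed.

Lemma lineproj_mul (R : realType) (n : nat) (v w : 'cV[R]_n) :
  lineproj v *m w = ((sqnorm v)^-1 * (v^T *m w) 0 0) *: v.
Proof.
rewrite /lineproj -scalemxAl -mulmxA; set u := v^T *m w.
by rewrite {1}[u]mx11_scalar mul_mx_scalar scalerA.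
Qed.

Lemma axialP (R : realType) (n : nat) (v : 'cV[R]_n) (a c : R) (A : 'M[R]_n) :
  v != 0 ->
  A = axial v a c <->
  A *m v = a *: v /\ forall w : 'cV[R]_n, v^T *m w = 0 -> A *m w = c *: w.
Proof.
move=> v0; split=> [->|[Av Aw]].
  split=> [|w vw]; rewrite axial_mul.
    by rewrite lineproj_self// subrr scaler0 addr0.
  by rewrite lineproj_orth// subr0 scaler0 add0r.
suff Ax (x : 'cV[R]_n) : A *m x = axial v a c *m x.
  apply/matrixP => i j; have /matrixP/(_ i 0) := Ax (delta_mx j 0).
  by rewrite -!colE !mxE.
have vQ : v^T *m (x - lineproj v *m x) = 0.
  by rewrite mulmxBr mulmxA -{1}lineproj_tr -trmx_mul lineproj_self// subrr.
have AP : A *m (lineproj v *m x) = a *: (lineproj v *m x).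
  by rewrite lineproj_mul -scalemxAr Av !scalerA mulrC.
by rewrite -{1}(subrK (lineproj v *m x) x) mulmxDr AP Aw// addrC axial_mul.
Qed.

Lemma axial_eigen (R : realType) (n : nat) (v : 'cV[R]_n) (a c : R)
    (f : R -> R) (w : 'cV[R]_n) (l : R) : v != 0 ->
  axial v a c *m w = l *: w -> axial v (f a) (f c) *m w = f l *: w.
Proof.
move=> v0; have [Av Aw] := (axialP a c (axial v a c) v0).1 erefl.
have [Fv Fw] := (axialP (f a) (f c) (axial v (f a) (f c)) v0).1 erefl.
move=> wl; have PE := lineproj_mul v w.
have vA : v^T *m (axial v a c *m w) = a *: (v^T *m w).
  by rewrite mulmxA -{1}axial_tr -trmx_mul Av linearZ /= scalemxAl.
have := vA; rewrite wl -scalemxAr => /eqP; rewrite -subr_eq0 -scalerBl.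
rewrite scaler_eq0 subr_eq0 => /orP[/eqP la|/eqP vw0]; last first.
  have := Aw _ vw0; rewrite wl => /eqP; rewrite -subr_eq0 -scalerBl.
  rewrite scaler_eq0 subr_eq0 => /orP[/eqP ->|/eqP ->]; first exact: Fw.
  by rewrite mulmx0 scaler0.
have vQ : v^T *m (w - lineproj v *m w) = 0.
  by rewrite mulmxBr mulmxA -{1}lineproj_tr -trmx_mul lineproj_self// subrr.
have axP a' c' : axial v a' c' *m v = a' *: v ->
    axial v a' c' *m (lineproj v *m w) = a' *: (lineproj v *m w).
  by move=> h; rewrite PE -scalemxAr h !scalerA mulrC.
have := Aw _ vQ; rewrite mulmxBr wl (axP _ _ Av) la -scalerBr => /eqP.
rewrite -subr_eq0 -scalerBl scaler_eq0 => /orP[|].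
  rewrite subr_eq0 => /eqP ac.
  by rewrite axial_mul -ac -scalerDr addrC subrK.
by rewrite subr_eq0 => /eqP wP; rewrite {1}wP (axP _ _ Fv) -wP.
Qed.

Lemma fMk_eigen (R : realType) (n : nat) (mu lam delta beta : R) (f : R -> R)
    (k : 'cV[int]_n) (w : 'cV[R]_n) (l : R) : k != 0 ->
  Mk mu lam delta beta k *m w = l *: w ->
  fMk mu lam delta beta f k *m w = f l *: w.
Proof. by move=> k0; apply: axial_eigen; rewrite intvec_eq0. Qed.

Lemma Mk_unit (R : realType) (n : nat) (mu lam delta beta : R)
    (k : 'cV[int]_n) : k != 0 ->
  lambda1 mu lam delta beta (intvec R k) != 0 ->
  lambda2 mu delta beta (intvec R k) != 0 ->
  Mk mu lam delta beta k \in unitmx.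
Proof.
rewrite -(intvec_eq0 R) /Mk; set v := intvec R k; set a := lambda1 _ _ _ _ v.
set c := lambda2 _ _ _ v => k0 a0 c0.
suff /mulmx1_unit[] : axial v a c *m axial v a^-1 c^-1 = 1%:M by [].
have [Av Aw] := (axialP a c (axial v a c) k0).1 erefl.
have [Bv Bw] := (axialP a^-1 c^-1 (axial v a^-1 c^-1) k0).1 erefl.
have -> : axial v a c *m axial v a^-1 c^-1 = axial v 1 1.
  apply/axialP => //; split=> [|w vw]; rewrite -mulmxA.
    by rewrite Bv -scalemxAr Av scalerA mulVf.
  by rewrite (Bw _ vw) -scalemxAr (Aw _ vw) scalerA mulVf.
by rewrite /axial !scale1r addrC subrK.
Qed.

(* Main.v *)
Require Import Defs.
From mathcomp Require Import all_boot all_order all_algebra.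
From mathcomp Require Import all_classical all_reals all_analysis.
From mathcomp Require Import complex ring lra.

Set Implicit Arguments.
Unset Strict Implicit.
Unset Printing Implicit Defensive.

Import Order.TTheory GRing.Theory Num.Theory.
Import numFieldNormedType.Exports.
Local Open Scope classical_set_scope.
Local Open Scope complex_scope.
Local Open Scope ring_scope.

(** The mode [k] of [Usol] is acted upon by the two scalar multipliers
(1 - cos (s t)) / s^2, with s^2 = - lambda_i(k).  After m >= 2 derivatives in t
such a multiplier becomes s^(m-2) times a bounded trigonometric factor, and for
m < 2 it is bounded locally in t, uniformly in s, since 1 - cos (s t) = O(s^2):
small values of s do no harm.  Hence everything follows from an upper bound
   - lambda_i(k) <= A (1 + |k|^2)^th,
namely th = 0 if beta < n, any th > 0 if beta = n, and th = (beta - n)/2 if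
beta > n: then N derivatives cost at most (N - 2) th powers of 1 + |k|^2, and
[q + (N - 2) th <= S] is exactly what is needed.  No power is lost on top of
this, because convergence of the difference quotients in the norm of H^q is a
dominated convergence argument over the modes, for which a bound of the
derivative itself suffices ([jet_Hderiv]).

For the upper bound ([lambda_growth]), put b = (n+2)/2, g = (n-beta)/2 and
y = delta^2 |k|^2 / 4, and let phi(y) = 0F1(; b; -y), a rescaled Bessel
function. Partial fractions express the multipliers through phi and through
   G(y) = y^(-g) int_0^y u^(g-1) (phi(u) - 1) du,
   H(y) = (g+1) y^(-g-1) int_0^y u^g phi(u) du.
Here lambda_2 is a multiple of G ([hyperg23]); in lambda_1 the 3F4 contributes a
combination of phi - 1 and G ([hyperg34]), and the 1F2 a multiple of y H^2
([hyperg12]).  An energy of the Bessel equation is monotone when b >= 3/2, which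
gives y phi^2 <= (b-1)/2 ([bessel_decay]).  No integral is needed to conclude:
G and H solve y G' + g G = phi - 1 and y H' + (g+1) H = (g+1) phi, read off from
the coefficients, and a comparison principle for such equations
([first_order_growth]) turns the bound on phi into G = O(y^th) and
y H^2 = O(y^th). *)

(** * Power series of entire functions *)

(** Coefficients of a power series of exponential type; unlike convergence
everywhere, this bound is visibly stable under formal derivation. *)
Definition exp_type (R : realType) (c : R^nat) : Prop :=
  exists A B : R, 0 <= B /\ forall m, `|c m| <= A * B ^+ m / m`!%:R.

Lemma exp_type_le (R : realType) (c d : R^nat) (K : R) :
  exp_type c -> (forall m, `|d m| <= K * `|c m|) -> exp_type d.
Proof.
move=> [A [B [B0 cAB]]] dc; exists (`|K| * A), B; split=> // m.
apply: (le_trans (dc m)).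
rewrite -2!mulrA; apply: (@le_trans _ _ (`|K| * `|c m|)).
  by rewrite ler_wpM2r// ler_norm.
by rewrite ler_wpM2l// mulrA.
Qed.

Lemma exp_type_cvg (R : realType) (c : R^nat) (x : R) :
  exp_type c -> cvgn (pseries c x).
Proof.
move=> [A [B [B0 cAB]]]; apply: normed_cvg.
have A0 : 0 <= A by have := cAB 0%N; rewrite expr0 mulr1 divr1; apply: le_trans.
rewrite /normed_series_of.
apply: (@series_le_cvg _ _ (A *: exp_coeff (B * `|x|))) => [n|n|n|] /=.
- exact: normr_ge0.
- by apply: mulr_ge0 => //; rewrite divr_ge0// exprn_ge0// mulr_ge0.
- rewrite normrM normrX.
  rewrite [leRHS](_ : _ = A * ((B * `|x|) ^+ n / n`!%:R)) //.
  have -> : A * ((B * `|x|) ^+ n / n`!%:R) = A * B ^+ n / n`!%:R * `|x| ^+ n.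
    by rewrite exprMn -!mulrA (mulrC (_ ^+ n) (_^-1)).
  by rewrite ler_wpM2r ?exprn_ge0.
- by apply: is_cvg_seriesZ; exact: is_cvg_series_exp_coeff.
Qed.

Lemma exp_type_diffs (R : realType) (c : R^nat) :
  exp_type c -> exp_type (pseries_diffs c).
Proof.
move=> [A [B [B0 cAB]]]; exists (A * B), B; split=> // m.
rewrite /pseries_diffs normrM normr_nat -ler_pdivlMl// (le_trans (cAB _))//.
rewrite factS natrM invfM exprS !mulrA.
by rewrite -(mulrC m.+1%:R^-1) !mulrA.
Qed.

Lemma exp_type_shift (R : realType) (c : R^nat) :
  exp_type c -> exp_type (fun m => c m.+1).
Proof.
move=> /exp_type_diffs h; apply: (@exp_type_le _ _ _ 1 h) => m.
by rewrite mul1r /pseries_diffs normrM normr_nat ler_peMl// ler1n.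
Qed.

Definition psum (R : realType) (c : R^nat) (x : R) : R := limn (pseries c x).

Lemma psum_cvg (R : realType) (c : R^nat) (x : R) :
  exp_type c -> pseries c x @ \oo --> psum c x.
Proof. exact: exp_type_cvg. Qed.

Lemma psumP (R : realType) (c : R^nat) (x l : R) :
  pseries c x @ \oo --> l -> psum c x = l.
Proof. by move=> cl; apply/cvg_lim. Qed.

Lemma psum0 (R : realType) (c : R^nat) : psum c 0 = c 0%N.
Proof.
apply: psumP; rewrite -cvg_shiftS.
rewrite (_ : (fun n => _) = cst (c 0%N)); first exact: cvg_cst.
apply/funext => n; rewrite /pseries /series /= big_nat_recl//= expr0 mulr1.
by rewrite big1 ?addr0// => i _; rewrite exprS mul0r mulr0.
Qed.

Lemma is_derive_psum (R : realType) (c : R^nat) (x : R) :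
  exp_type c -> is_derive x (1 : R) (psum c) (psum (pseries_diffs c) x).
Proof.
move=> ce; have de := exp_type_diffs ce.
apply: (@pseries_snd_diffs _ _ (`|x| + 1)); try exact: exp_type_cvg.
  by apply/exp_type_cvg/exp_type_diffs.
by rewrite [ltRHS]ger0_norm ?addr_ge0// ltrDl.
Qed.

Lemma pseries_lin (R : realType) (c d : R^nat) (u v x l m : R) :
  pseries c x @ \oo --> l -> pseries d x @ \oo --> m ->
  pseries (fun i => u * c i + v * d i) x @ \oo --> u * l + v * m.
Proof.
move=> cl dm.
have -> : pseries (fun i => u * c i + v * d i) x =
    (fun n => u * pseries c x n + v * pseries d x n).
  apply/funext => n; rewrite /pseries /series /= !mulr_sumr -big_split /=.
  by apply: eq_bigr => i _; rewrite mulrDl !mulrA.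
by apply: cvgD; apply: cvgMr.
Qed.

Lemma pseries_shift (R : realType) (c : R^nat) (x l : R) : c 0%N = 0 ->
  pseries (fun m => c m.+1) x @ \oo --> l -> pseries c x @ \oo --> x * l.
Proof.
move=> c0 cl; rewrite -cvg_shiftS.
have -> : (fun n => pseries c x n.+1) =
    (fun n => x * pseries (fun m => c m.+1) x n).
  apply/funext => n; rewrite /pseries /series /= big_nat_recl//= c0 mul0r add0r.
  by rewrite mulr_sumr; apply: eq_bigr => i _; rewrite exprS mulrCA.
exact: cvgMr.
Qed.

(** The Euler operator y d/dy multiplies the m-th coefficient by m; through it,
differential equations are checked coefficientwise. *)
Lemma pseries_euler (R : realType) (c : R^nat) (x : R) : exp_type c ->
  pseries (fun m => m%:R * c m) x @ \oo --> x * psum (pseries_diffs c) x.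
Proof.
move=> ce; apply: pseries_shift; first by rewrite mul0r.
exact/psum_cvg/exp_type_diffs.
Qed.

Lemma pseries_cst1 (R : realType) (x : R) :
  pseries (fun m => (m == 0%N)%:R) x @ \oo --> (1 : R).
Proof.
rewrite -cvg_shiftS.
have -> : (fun n => pseries (fun m => (m == 0%N)%:R) x n.+1) = cst (1:R).
  apply/funext => n; rewrite /pseries /series /= big_nat_recl//= mul1r.
  by rewrite big1 ?addr0// => i _; rewrite mul0r.
exact: cvg_cst.
Qed.

(** * Comparison principles *)

(** Differentiation rules for functions given pointwise, with derivatives in
plain ring operations rather than in the module operations of the normed space
[R], so that [ring] and [field] apply to the results. *)
Lemma is_derive_addf (R : realType) (f g : R -> R) (x df dg : R) :
  is_derive x (1 : R) f df -> is_derive x (1 : R) g dg ->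
  is_derive x (1 : R) (fun y => f y + g y) (df + dg).
Proof. by move=> ? ?; exact: is_deriveD. Qed.

Lemma is_derive_mulf (R : realType) (f g : R -> R) (x df dg : R) :
  is_derive x (1 : R) f df -> is_derive x (1 : R) g dg ->
  is_derive x (1 : R) (fun y => f y * g y) (df * g x + f x * dg).
Proof.
move=> ? ?; apply: (is_derive_eq (is_deriveM _ _)).
by rewrite /GRing.scale/= addrC (mulrC df).
Qed.

Lemma is_derive_oppf (R : realType) (f : R -> R) (x df : R) :
  is_derive x (1 : R) f df -> is_derive x (1 : R) (fun y => - f y) (- df).
Proof. by move=> ?; exact: is_deriveN. Qed.

Lemma is_derive_cstM (R : realType) (a : R) (f : R -> R) (x df : R) :
  is_derive x (1 : R) f df -> is_derive x (1 : R) (fun y => a * f y) (a * df).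
Proof. by move=> ?; exact: is_deriveZ. Qed.

Lemma ge0_derive_le (R : realType) (f df : R -> R) (a b : R) : a <= b ->
  (forall x, a <= x <= b -> is_derive x (1 : R) f (df x)) ->
  (forall x, a <= x <= b -> 0 <= df x) -> f a <= f b.
Proof.
move=> ab fd df0.
have [||c] := @MVT_segment R f df a b ab.
- by move=> x; rewrite in_itv/= => /andP[ax xb]; apply: fd; rewrite !ltW.
- apply: continuous_in_subspaceT => x /[!inE]/=; rewrite in_itv/= => axb.
  apply/differentiable_continuous/derivable1_diffP.
  by have [] := fd _ axb.
rewrite in_itv/= => acb E.
by rewrite -subr_ge0 E mulr_ge0 ?df0 ?subr_ge0.
Qed.

Lemma norm_derive_le (R : realType) (f df g dg : R -> R) (a b : R) : a <= b ->
  (forall x, a <= x <= b -> is_derive x (1 : R) f (df x)) ->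
  (forall x, a <= x <= b -> is_derive x (1 : R) g (dg x)) ->
  (forall x, a <= x <= b -> `|df x| <= dg x) -> `|f b - f a| <= g b - g a.
Proof.
move=> ab fd gd h.
have fg : g a + - f a <= g b + - f b.
  apply: (@ge0_derive_le _ (fun x => g x + - f x) (fun x => dg x + - df x))
    => // x axb.
    exact: is_derive_addf (gd x axb) (is_derive_oppf (fd x axb)).
  by rewrite subr_ge0 (le_trans (ler_norm _))// h.
have gf : g a + f a <= g b + f b.
  apply: (@ge0_derive_le _ (fun x => g x + f x) (fun x => dg x + df x))
    => // x axb.
    exact: is_derive_addf (gd x axb) (fd x axb).
  by have := h _ axb; rewrite ler_norml => /andP[]; lra.
by rewrite ler_norml; apply/andP; split; lra.
Qed.

Lemma powR_le_powR (R : realType) (y0 y s t : R) : 0 < y0 -> y0 <= y ->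
  s <= t -> y `^ s <= y0 `^ (s - t) * y `^ t.
Proof.
move=> y00 y0y st; have y_gt0 : 0 < y by exact: lt_le_trans y0y.
rewrite -ler_pdivrMr ?powR_gt0// -powRB ?(gt_eqF y_gt0) ?implybT//.
rewrite -(opprB t s) !powRN lef_pV2 ?posrE ?powR_gt0//.
by rewrite ge0_ler_powR ?nnegrE ?subr_ge0// ltW.
Qed.

(** The equation y W' + alpha W = f says that (y^alpha W)' = y^(alpha-1) f, so
the bound |f| <= M y^sigma makes y^alpha W grow at most like the primitive
M y^(alpha+sigma) / (alpha+sigma), plus a constant: W is
O(y^sigma + y^(-alpha)). The primitive would be a logarithm if alpha + sigma
were 0. *)
Lemma first_order_growth (R : realType) (W W' : R -> R)
    (alpha sigma tau M y0 : R) :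
  0 < y0 -> alpha + sigma != 0 -> sigma <= tau -> - alpha <= tau ->
  (forall y, y0 <= y -> is_derive y (1 : R) W (W' y)) ->
  (forall y, y0 <= y -> `|y * W' y + alpha * W y| <= M * y `^ sigma) ->
  exists C, forall y, y0 <= y -> `|W y| <= C * y `^ tau.
Proof.
move=> y00 as0 st at_ Wd WM.
set e := alpha + sigma in as0 *.
pose K := `|y0 `^ alpha * W y0| + `|M / e * y0 `^ e|.
exists (K * y0 `^ (- alpha - tau) + `|M / e| * y0 `^ (sigma - tau)) => y y0y.
have y_gt0 : 0 < y by exact: lt_le_trans y0y.
have pd (z r : R) : y0 <= z ->
      is_derive z (1 : R) (fun x => x `^ r) (r * z `^ (r - 1)).
  by move=> y0z; apply: is_derive1_powR; exact: lt_le_trans y0z.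
have main : `|y `^ alpha * W y - y0 `^ alpha * W y0| <=
    M / e * y `^ e - M / e * y0 `^ e.
  apply: (@norm_derive_le _ (fun z => z `^ alpha * W z)
    (fun z => z `^ (alpha - 1) * (z * W' z + alpha * W z))
    (fun z => M / e * z `^ e) (fun z => M * z `^ (e - 1)) _ _ y0y)
    => z /andP[y0z _];
    have z_gt0 : 0 < z by exact: lt_le_trans y0z.
  - have := pd z alpha y0z; have := Wd z y0z => ? ?.
    apply: (is_derive_eq (is_deriveM _ _)).
    have zE : z `^ alpha = z * z `^ (alpha - 1).
      rewrite -{2}(@powRr1 _ z) ?ltW// -powRD ?(gt_eqF z_gt0) ?implybT//.
      by rewrite addrC subrK.
    by rewrite /GRing.scale/= zE; ring.
  - have := pd z e y0z => ?.
    apply: (is_derive_eq (is_deriveZ _ _)).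
    by rewrite /GRing.scale/= mulrA divfK.
  - rewrite normrM ger0_norm ?powR_ge0//.
    have -> : M * z `^ (e - 1) = z `^ (alpha - 1) * (M * z `^ sigma).
      rewrite mulrCA -powRD ?(gt_eqF z_gt0) ?implybT//; congr (_ * (_ `^ _)).
      by rewrite /e; ring.
    by rewrite ler_wpM2l ?powR_ge0// WM.
have {}main : y `^ alpha * `|W y| <= K + `|M / e| * y `^ e.
  rewrite -[y `^ alpha]ger0_norm ?powR_ge0// -normrM.
  rewrite -(subrK (y0 `^ alpha * W y0) (y `^ alpha * W y)).
  apply: (le_trans (ler_normD _ _)).
  rewrite addrC /K -addrA lerD2l (le_trans main)// addrC lerD//.
    by rewrite ler_wpM2r ?powR_ge0// ler_norm.
  by rewrite -normrN ler_norm.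
rewrite -(ler_pM2l (powR_gt0 alpha y_gt0)) (le_trans main)//.
rewrite mulrDl mulrDr lerD//.
  rewrite -mulrA mulrCA ler_peMr//; first by rewrite /K addr_ge0.
  rewrite -ler_pdivrMl ?powR_gt0// mulr1 -powRN.
  exact: powR_le_powR.
rewrite /e powRD ?(gt_eqF y_gt0) ?implybT// mulrCA ler_wpM2l ?powR_ge0//.
by rewrite -mulrA ler_wpM2l// powR_le_powR.
Qed.

(** * The Bessel profile *)

Lemma pochhammerS (R : realType) (a : R) (m : nat) :
  pochhammer a m.+1 = pochhammer a m * (a + m%:R).
Proof. by rewrite /pochhammer big_ord_recr. Qed.

Lemma pochhammer_gt0 (R : realType) (a : R) (m : nat) :
  0 < a -> 0 < pochhammer a m.
Proof. by move=> a0; rewrite prodr_gt0// => i _; rewrite ltr_wpDr. Qed.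

Lemma pochhammer_ge1 (R : realType) (a : R) (m : nat) :
  1 <= a -> 1 <= pochhammer a m.
Proof.
move=> a1; elim: m => [|m IH]; first by rewrite /pochhammer big_ord0.
by rewrite pochhammerS -[1]mulr1 ler_pM// (le_trans a1)// lerDl.
Qed.

Lemma pochhammer_shift (R : realType) (a : R) (m : nat) :
  a * pochhammer (a + 1) m = pochhammer a m * (a + m%:R).
Proof.
rewrite -pochhammerS /pochhammer big_ord_recl/= addr0; congr (_ * _).
by apply: eq_bigr => i _; rewrite /bump/= natrD; ring.
Qed.

Lemma pochhammer1 (R : realType) (m : nat) : pochhammer (1 : R) m = m`!%:R.
Proof.
elim: m => [|m IH]; first by rewrite /pochhammer big_ord0.
by rewrite pochhammerS IH factS natrM -natr1 addrC mulrC.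
Qed.

(** The coefficients of phi(y) = 0F1(; b; -y), which is
Gamma(b) y^((1-b)/2) J_(b-1)(2 sqrt y). *)
Definition bessel_coeff (R : realType) (b : R) (m : nat) : R :=
  (-1) ^+ m / (pochhammer b m * m`!%:R).

Section bessel.
Context {R : realType} (b : R).
Hypothesis b32 : 3 / 2 <= b.
Local Notation c := (bessel_coeff b).
Local Notation phi := (psum c).
Local Notation phi' := (psum (pseries_diffs c)).
Local Notation phi'' := (psum (pseries_diffs (pseries_diffs c))).

Let b_gt0 : 0 < b. Proof. by apply: lt_le_trans b32; lra. Qed.

Lemma bessel_exp_type : exp_type c.
Proof.
exists 1, 1; split=> // m; rewrite expr1n mul1r /bessel_coeff.
rewrite normrM normrX normrN1 expr1n mul1r normfV ger0_norm; last first.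
  by rewrite mulr_ge0// ltW// pochhammer_gt0.
rewrite invfM mul1r ler_piMl// invf_le1 ?pochhammer_gt0//.
by rewrite pochhammer_ge1// (le_trans _ b32)//; lra.
Qed.

Lemma bessel_coeffS m :
  m.+1%:R * (b + m%:R) * c m.+1 + c m = 0.
Proof.
have b0 := b_gt0; have p0 := pochhammer_gt0 m b0.
have f0 : m`!%:R != 0 :> R by rewrite pnatr_eq0 -lt0n fact_gt0.
have bm : b + m%:R != 0 by rewrite gt_eqF// ltr_wpDr.
have nS : m.+1%:R != 0 :> R by rewrite pnatr_eq0.
rewrite /bessel_coeff exprS pochhammerS factS natrM; field.
by rewrite bm f0 nat1r nS gt_eqF.
Qed.

Lemma bessel_ode y : y * phi'' y + b * phi' y + phi y = 0.
Proof.
have ce := bessel_exp_type; have de := exp_type_diffs ce.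
have := @pseries_lin _ _ _ b 1 _ _ _ (psum_cvg (x := y) de)
  (psum_cvg (x := y) ce).
move=> /(@pseries_lin _ _ _ 1 1 _ _ _ (pseries_euler (x := y) de)).
rewrite (_ : (fun _ => _) = (fun=> 0)); last first.
  apply/funext => m; rewrite /pseries_diffs -[RHS](bessel_coeffS m); ring.
rewrite (_ : pseries _ _ = cst 0); last first.
  by apply/funext => m; rewrite /pseries /series/= big1// => i _; rewrite mul0r.
rewrite !mul1r addrA => h; apply/esym.
by apply: (cvg_unique (@Rhausdorff R) (cvg_cst 0) h).
Qed.

(** By the Bessel equation, the energy
   y phi^2 + y^2 phi'^2 + y phi phi' + (b-1)/2 phi^2
has derivative (3 - 2 b) y phi'^2 <= 0, and it equals (b-1)/2 at 0.  It bounds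
y phi^2 from above because y^2 phi'^2 + y phi phi' >= - phi^2 / 4 and
(b-1)/2 >= 1/4. *)
Lemma bessel_decay y : 0 <= y -> y * phi y ^+ 2 <= (b - 1) / 2.
Proof.
move=> y0; have ce := bessel_exp_type; have de := exp_type_diffs ce.
(* The opposite of the energy, which is nondecreasing. *)
pose K x := - (x * (phi x * phi x) + (x * phi' x) * (x * phi' x) +
  x * (phi x * phi' x) + (b - 1) / 2 * (phi x * phi x)).
have Kd (x : R) : 0 <= x <= y ->
    is_derive x (1 : R) K ((2 * b - 3) * (x * phi' x ^+ 2)).
  move=> _.
  have Dx : is_derive x (1 : R) (fun y : R => y) 1 by exact: is_derive_id.
  have Df := is_derive_psum x ce; have Dg := is_derive_psum x de.
  have Dxg := is_derive_mulf Dx Dg; have Dff := is_derive_mulf Df Df.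
  have D := is_derive_addf (is_derive_addf (is_derive_mulf Dx Dff)
    (is_derive_mulf Dxg Dxg)) (is_derive_mulf Dx (is_derive_mulf Df Dg)).
  have {}D := is_derive_oppf
    (is_derive_addf D (is_derive_cstM ((b - 1) / 2) Dff)).
  apply: (is_derive_eq D).
  rewrite /=; have := bessel_ode x; move: (phi x) (phi' x) (phi'' x) => p q r h.
  apply/eqP; rewrite -subr_eq0; apply/eqP.
  (* The energy identity holds modulo the Bessel equation, with multiplier
     - (2 x phi' + phi). *)
  transitivity (- (2 * x * q + p) * (x * r + b * q + p)); first by field.
  by rewrite h mulr0.
have KK : K 0 <= K y.
  apply: (ge0_derive_le y0 Kd) => x /andP[x0 _].
  have b3 : 0 <= 2 * b - 3 by have := b32; lra.
  by rewrite mulr_ge0// mulr_ge0// sqr_ge0.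
have phi0 : phi 0 = 1.
  by rewrite psum0 /bessel_coeff expr0 /pochhammer big_ord0 mulr1 divr1.
move: KK; rewrite /K phi0 lerN2 !mul0r !add0r !mulr1.
have b14 : 0 <= b - 1 - 1 / 2 by have := b32; lra.
move: (phi y) (phi' y) => p q.
have := mulr_ge0 b14 (sqr_ge0 p); have := sqr_ge0 (y * q + p / 2).
by rewrite !expr2; lra.
Qed.
End bessel.

(** * Weighted means of the Bessel profile *)

Lemma psum_euler (R : realType) (d f : R^nat) (alpha y l : R) :
  exp_type d -> (forall m, m%:R * d m + alpha * d m = f m) ->
  pseries f y @ \oo --> l ->
  y * psum (pseries_diffs d) y + alpha * psum d y = l.
Proof.
move=> de df fl.
have := @pseries_lin _ _ _ 1 alpha _ _ _ (pseries_euler (x := y) de)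
  (psum_cvg (x := y) de).
rewrite (_ : (fun _ => _) = f) ?mul1r; last first.
  by apply/funext => m; rewrite mul1r.
by move=> h; apply: (cvg_unique (@Rhausdorff R) h fl).
Qed.

(** The coefficients of y^(-g) int_0^y u^(g-1) (phi(u) - 1) du: the term u^m of
phi - 1 contributes y^m / (g + m). The constant term is absent, hence [g] need
only be larger than -1 for the denominators not to vanish. *)
Definition defect_coeff (R : realType) (b g : R) (m : nat) : R :=
  if m == 0%N then 0 else bessel_coeff b m / (g + m%:R).

(** The coefficients of (g+1) y^(-g-1) int_0^y u^g phi(u) du, the mean of phi
for the weight u^g. *)
Definition mean_coeff (R : realType) (b g : R) (m : nat) : R :=
  (g + 1) / (g + 1 + m%:R) * bessel_coeff b m.

Section growth.
Context {R : realType} (b g y0 : R).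
Hypotheses (b32 : 3 / 2 <= b) (gN1 : -1 < g) (y00 : 0 < y0).
Local Notation phi := (psum (bessel_coeff b)).
Local Notation G := (psum (defect_coeff b g)).
Local Notation H := (psum (mean_coeff b g)).

Let g1 : 0 < g + 1. Proof. by rewrite -ltrBlDr sub0r. Qed.

Let gm (m : nat) : (0 < m)%N -> g + 1 <= g + m%:R.
Proof. by move=> m0; rewrite lerD2l ler1n. Qed.

Lemma defect_exp_type : exp_type (defect_coeff b g).
Proof.
apply: (@exp_type_le _ _ _ (g + 1)^-1 (bessel_exp_type b32)) => m.
rewrite /defect_coeff; case: (posnP m) => [->|m0].
  by rewrite normr0 mulr_ge0// invr_ge0 ltW.
rewrite normrM mulrC ler_wpM2r// normfV.
have gm0 : 0 < g + m%:R by exact: lt_le_trans (gm m0).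
by rewrite ger0_norm ?lef_pV2 ?posrE ?gm// ltW.
Qed.

Lemma mean_exp_type : exp_type (mean_coeff b g).
Proof.
apply: (@exp_type_le _ _ _ 1 (bessel_exp_type b32)) => m.
rewrite /mean_coeff normrM ler_wpM2r//.
have gm0 : 0 < g + 1 + m%:R by rewrite ltr_wpDr.
rewrite ger0_norm; last by rewrite divr_ge0// ltW.
by rewrite ler_pdivrMr// mul1r lerDl.
Qed.

Lemma defect_euler y :
  y * psum (pseries_diffs (defect_coeff b g)) y + g * G y = phi y - 1.
Proof.
have -> : phi y - 1 = 1 * phi y + (-1) * 1 by ring.
apply: (psum_euler defect_exp_type); last first.
  exact: pseries_lin (psum_cvg (bessel_exp_type b32)) (@pseries_cst1 R y).
move=> m; rewrite /defect_coeff; case: (posnP m) => [->|m0].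
  by rewrite /bessel_coeff /pochhammer big_ord0 expr0 fact0 /=; field.
have gm0 : g + m%:R != 0 by rewrite gt_eqF// (lt_le_trans _ (gm m0)).
by rewrite mulr0 addr0 mul1r -mulrDl addrC mulrC divfK.
Qed.

Lemma mean_euler y :
  y * psum (pseries_diffs (mean_coeff b g)) y + (g + 1) * H y = (g + 1) * phi y.
Proof.
have -> : (g + 1) * phi y = (g + 1) * phi y + 0 * phi y by ring.
apply: (psum_euler mean_exp_type); last first.
  have phi_cvg : pseries (bessel_coeff b) y @ \oo --> phi y.
    exact/psum_cvg/bessel_exp_type.
  exact: (pseries_lin phi_cvg phi_cvg).
move=> m; rewrite /mean_coeff mul0r addr0 -mulrDl (addrC m%:R) mulrA.
congr (_ * _).
by rewrite mulrC divfK// gt_eqF// ltr_wpDr.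
Qed.

Lemma bessel_growth (s : R) : - (1 / 2) <= s ->
  exists2 C, 0 <= C & forall y, y0 <= y -> `|phi y| <= C * y `^ s.
Proof.
move=> s12; exists (Num.sqrt ((b - 1) / 2) * y0 `^ (- (1 / 2) - s)) => [|y y0y].
  by rewrite mulr_ge0 ?powR_ge0 ?sqrtr_ge0.
have y_gt0 : 0 < y by exact: lt_le_trans y0y.
apply: (@le_trans _ _ (Num.sqrt ((b - 1) / 2) * y `^ (- (1 / 2)))); last first.
  by rewrite -mulrA ler_wpM2l ?sqrtr_ge0// powR_le_powR.
rewrite powRN ler_pdivlMr ?powR_gt0// div1r powR12_sqrt ?(ltW y_gt0)//.
rewrite -sqrtr_sqr -sqrtrM ?sqr_ge0//. rewrite ler_sqrt ?bessel_decay//.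
  by rewrite mulrC bessel_decay// ltW.
by rewrite divr_ge0// subr_ge0 (le_trans _ b32)//; lra.
Qed.

Lemma defect_growth (th : R) : 0 <= th -> 0 <= th + g -> (g = 0 -> 0 < th) ->
  exists C, forall y, y0 <= y -> `|G y| <= C * y `^ th.
Proof.
move=> th0 thg g0.
(* The exponent s of the bound on phi - 1 must avoid the resonance g + s = 0:
   this is the logarithm of the case g = 0, paid for by an arbitrary th > 0. *)
have [s [s0 sth gs]] : exists s, [/\ 0 <= s, s <= th & g + s != 0].
  have [gE|gN] := eqVneq g 0; last by exists 0; rewrite addr0.
  by exists th; rewrite gE add0r gt_eqF ?g0.
have [|C C0 Cphi] := @bessel_growth s; first by lra.
apply: (@first_order_growth _ G (psum (pseries_diffs (defect_coeff b g))) g s th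
    (C + y0 `^ (0 - s)) y0) => //.
- by lra.
- by move=> y _; exact/is_derive_psum/defect_exp_type.
move=> y y0y; rewrite defect_euler (le_trans (ler_normB _ _))//.
rewrite mulrDl lerD ?Cphi//.
by rewrite normr1 -[leLHS](powRr0 y) powR_le_powR.
Qed.

(** Squaring gives y H^2 = O(y^th). The resonance never occurs here, since
g + 1 + (th - 1)/2 >= (g + 1)/2 > 0. *)
Lemma mean_growth (th : R) : 0 <= th -> 0 <= th + g ->
  exists C, forall y, y0 <= y -> `|H y| <= C * y `^ ((th - 1) / 2).
Proof.
move=> th0 thg.
have [|C C0 Cphi] := @bessel_growth ((th - 1) / 2); first by lra.
apply: (@first_order_growth _ H (psum (pseries_diffs (mean_coeff b g))) (g + 1)
    ((th - 1) / 2) ((th - 1) / 2) ((g + 1) * C) y0) => //.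
- suff h : 0 < g + 1 + (th - 1) / 2 by rewrite gt_eqF.
  by have := g1; lra.
- by have := g1; lra.
- by move=> y _; exact/is_derive_psum/mean_exp_type.
move=> y y0y; rewrite mean_euler normrM ger0_norm ?(ltW g1)// -mulrA.
by rewrite ler_wpM2l ?(ltW g1)// Cphi.
Qed.

End growth.

(** * Hypergeometric series through the Bessel profile *)

Lemma hyperg_psum (R : realType) (a b : seq R) (c : R^nat) (y : R) :
  (forall m, (\prod_(d <- a) pochhammer d m) / (\prod_(d <- b) pochhammer d m) *
     ((-1) ^+ m / m`!%:R) = c m) ->
  hyperg a b (- y) = psum c y.
Proof.
move=> ac; rewrite /hyperg /psum /pseries; congr (limn (series _)).
apply/funext => m; rewrite /= -ac -!mulrA.
by rewrite (exprNn y) -mulrA (mulrC (y ^+ m)).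
Qed.

Section hyperg.
Context {R : realType} (b g : R).
Hypotheses (b32 : 3 / 2 <= b) (gN1 : -1 < g).
Local Notation phi := (psum (bessel_coeff b)).
Local Notation G := (psum (defect_coeff b g)).
Local Notation H := (psum (mean_coeff b g)).

Let g1 : 0 < g + 1. Proof. by rewrite -ltrBlDr sub0r. Qed.
Let b_gt0 : 0 < b. Proof. by apply: lt_le_trans b32; lra. Qed.

Let pochg2 m :
  pochhammer (g + 2) m = pochhammer (g + 1) m * (g + 1 + m%:R) / (g + 1).
Proof.
rewrite -pochhammer_shift mulrC mulKf ?gt_eqF//.
by congr pochhammer; ring.
Qed.

Let poch2 m : pochhammer (2 : R) m = m`!%:R * m.+1%:R.
Proof.
have := pochhammer_shift (1 : R) m.
by rewrite mul1r pochhammer1 nat1r => <-; congr pochhammer; ring.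
Qed.

Let poch52 m :
  pochhammer (5 / 2 : R) m = pochhammer (3 / 2) m * (1 + 2 / 3 * m%:R).
Proof.
have := pochhammer_shift (3 / 2 : R) m.
have -> : 3 / 2 + 1 = 5 / 2 :> R by field.
by move=> h; apply: (mulfI (_ : 3 / 2 != 0 :> R)); [lra|rewrite h; field].
Qed.

Let pochb1 m : pochhammer (b + 1) m = pochhammer b m * (b + m%:R) / b.
Proof. by rewrite -pochhammer_shift mulrC mulKf ?gt_eqF. Qed.

Let nz m : [/\ pochhammer b m != 0, pochhammer (g + 1) m != 0,
  g + 1 + m%:R != 0, b + m%:R != 0 & m`!%:R != 0 :> R].
Proof.
split; apply: lt0r_neq0.
- exact: pochhammer_gt0.
- exact: pochhammer_gt0.
- exact: ltr_wpDr.
- exact: ltr_wpDr.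
- by rewrite ltr0n fact_gt0.
Qed.

Lemma hyperg12 y : hyperg [:: g + 1] [:: b; g + 2] (- y) = H y.
Proof.
apply: hyperg_psum => m; have [nb ng ng1 nb1 nf] := nz m.
rewrite !big_cons !big_nil pochg2 /mean_coeff /bessel_coeff; field.
by rewrite nf nb ng1 ng gt_eqF.
Qed.

Lemma defect_shift y : y * psum (fun m => defect_coeff b g m.+1) y = G y.
Proof.
apply/esym/psumP; apply: pseries_shift => //.
exact/psum_cvg/exp_type_shift/defect_exp_type.
Qed.

Lemma bessel_shift y : y * psum (fun m => bessel_coeff b m.+1) y = phi y - 1.
Proof.
have cS := exp_type_shift (bessel_exp_type b32).
have h : pseries (fun m => 1 * bessel_coeff b m + (-1) * (m == 0%N)%:R) y
    @ \oo -->
    y * psum (fun m => bessel_coeff b m.+1) y.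
  apply: pseries_shift.
    by rewrite /bessel_coeff /pochhammer big_ord0 expr0 fact0 /=; field.
  rewrite (_ : (fun m => _) = (fun m => bessel_coeff b m.+1)); last first.
    by apply/funext => m; rewrite mulr0 addr0 mul1r.
  exact: psum_cvg cS.
have -> : phi y - 1 = 1 * phi y + (-1) * 1 by ring.
apply: (cvg_unique (@Rhausdorff R) h).
exact: pseries_lin (psum_cvg (bessel_exp_type b32)) (@pseries_cst1 R y).
Qed.

(** Up to the factor - (g+1) b, both sides have the coefficients
(-y)^j / ((g+j) (b)_j j!), the index being shifted by the factor y:
(1)_m / (2)_m = 1/(m+1) completes the factorial, and (b+1)_m = (b)_(m+1) / b. *)
Lemma hyperg23 y :
  y * hyperg [:: 1; g + 1] [:: 2; b + 1; g + 2] (- y) = - ((g + 1) * b) * G y.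
Proof.
rewrite (@hyperg_psum _ _ _ (fun m =>
    - ((g + 1) * b) * defect_coeff b g m.+1 + 0 * defect_coeff b g m.+1)).
  have lS := exp_type_shift (defect_exp_type b32 gN1).
  rewrite -defect_shift (psumP (pseries_lin (psum_cvg lS) (psum_cvg lS))).
  by ring.
move=> m; have [nb ng ng1 nb1 nf] := nz m.
have nS : m.+1%:R != 0 :> R by rewrite pnatr_eq0.
rewrite !big_cons !big_nil pochg2 poch2 pochb1 pochhammer1.
rewrite /defect_coeff /bessel_coeff /=.
rewrite exprS pochhammerS factS natrM.
have gS : g + m.+1%:R = g + 1 + m%:R by rewrite -nat1r addrA.
rewrite gS; field.
by rewrite nat1r nf nb ng1 ng nb1 nS !gt_eqF.
Qed.

(** The quotient (5/2)_m / (3/2)_m = (2m+3)/3 turns the coefficients of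
[hyperg23] into (2j+1)/(g+j) = 2 + (1-2g)/(g+j), with j = m+1. *)
Lemma hyperg34 y :
  3 * (y * hyperg [:: 1; 5 / 2; g + 1] [:: 2; 3 / 2; b + 1; g + 2] (- y)) =
  - ((g + 1) * b) * (2 * (phi y - 1) + (1 - 2 * g) * G y).
Proof.
pose K := - ((g + 1) * b) / 3.
have KE : - ((g + 1) * b) = 3 * K by rewrite /K; field.
rewrite (@hyperg_psum _ _ _ (fun m =>
    (2 * K) * bessel_coeff b m.+1 + ((1 - 2 * g) * K) * defect_coeff b g m.+1)).
  rewrite -defect_shift -bessel_shift KE -mulrA; congr (_ * _).
  have lS := exp_type_shift (defect_exp_type b32 gN1).
  have cS := exp_type_shift (bessel_exp_type b32).
  rewrite (psumP (pseries_lin (psum_cvg cS) (psum_cvg lS))).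
  by ring.
move=> m; have [nb ng ng1 nb1 nf] := nz m.
have nS : m.+1%:R != 0 :> R by rewrite pnatr_eq0.
have p32 : pochhammer (3 / 2 : R) m != 0.
  by rewrite gt_eqF// pochhammer_gt0//; lra.
rewrite !big_cons !big_nil pochg2 poch2 pochb1 pochhammer1 poch52.
rewrite /defect_coeff /bessel_coeff /=.
rewrite exprS pochhammerS factS natrM.
have gS : g + m.+1%:R = g + 1 + m%:R by rewrite -nat1r addrA.
rewrite gS /K; field.
by rewrite nat1r nf nb ng1 ng nb1 nS p32 !gt_eqF.
Qed.
End hyperg.

(** * Growth of the multipliers *)

Lemma sqnorm_ge0 (R : realType) (n : nat) (v : 'cV[R]_n) : 0 <= sqnorm v.
Proof. by apply: sumr_ge0 => i _; exact: sqr_ge0. Qed.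

Lemma sqnorm_intvec_ge1 (R : realType) (n : nat) (k : 'cV[int]_n) :
  k != 0 -> 1 <= sqnorm (intvec R k).
Proof.
move=> k0.
have [i ki] : exists i, k i 0 != 0.
  apply/existsP; apply: contraNT k0 => /existsPn h; apply/eqP/matrixP => i j.
  by rewrite ord1 mxE; apply/eqP; have := h i; rewrite negbK.
rewrite /sqnorm (bigD1 i)//= -[leLHS]addr0 mxE lerD//.
  rewrite -real_normK ?num_real// exprn_ege1// -intr_norm ler1z.
  by rewrite -gtz0_ge1 normr_gt0.
by apply: sumr_ge0 => j _; exact: sqr_ge0.
Qed.

(** Only modes with |k| >= 1 matter, that is y >= y0 = delta^2/4, which is why
the growth bounds are stated away from 0; at k = 0 both multipliers vanish. *)
Lemma lambda_growth (R : realType) (n : nat) (mu lam delta beta th : R) :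
  (0 < n)%N -> 0 < delta -> beta < n%:R + 2 ->
  0 <= th -> 0 <= th + (n%:R - beta) / 2 -> (beta = n%:R -> 0 < th) ->
  exists2 A, 0 <= A & forall k : 'cV[int]_n,
    - lambda1 mu lam delta beta (intvec R k)
      <= A * (1 + sqnorm (intvec R k)) `^ th /\
    - lambda2 mu delta beta (intvec R k)
      <= A * (1 + sqnorm (intvec R k)) `^ th.
Proof.
move=> n0 delta0 betan th0; set g := (n%:R - beta) / 2 => thg betath.
pose b : R := (n%:R + 2) / 2; pose y0 : R := 4^-1 * delta ^+ 2.
have n1 : 1 <= n%:R :> R by rewrite ler1n.
have b32 : 3 / 2 <= b by rewrite /b; lra.
have gN1 : -1 < g by rewrite /g; lra.
have y00 : 0 < y0 by rewrite /y0 mulr_gt0// exprn_gt0.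
have gth : g = 0 -> 0 < th by rewrite /g => h; apply: betath; lra.
have [CG Gle] := defect_growth b32 gN1 y00 th0 thg gth.
have [CH Hle] := mean_growth b32 gN1 y00 th0 thg.
have [|CP CP0 Ple] := @bessel_growth _ b y0 b32 y00 th; first by lra.
set K := (g + 1) * b.
have K0 : 0 <= K by rewrite /K mulr_ge0//; lra.
pose A1 := `|mu| * (K * (2 * (CP + y0 `^ (0 - th)) + `|1 - 2 * g| * CG)) +
  `|lam - mu| * CH ^+ 2.
pose A2 := `|mu| * (K * CG).
pose D := (y0^-1 * y0 `^ th).
exists (`|D * A1| + `|D * A2|) => [|k]; first by rewrite addr_ge0.
have [->|k0] := eqVneq k 0.
  have s0 : sqnorm (intvec R (0 : 'cV[int]_n)) = 0.
    by apply/eqP; rewrite sqnorm_eq0 intvec_eq0.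
  rewrite /lambda1 /lambda2 s0 oppr0 !mul0r mulr0 mul0r oppr0.
  by split; rewrite mulr_ge0 ?powR_ge0 ?addr_ge0.
have r1 := sqnorm_intvec_ge1 R k0; set r := sqnorm (intvec R k) in r1 *.
have r0 : 0 < r by exact: lt_le_trans r1.
pose y := 4^-1 * r * delta ^+ 2.
have yE : y = y0 * r by rewrite /y /y0; ring.
have y0y : y0 <= y by rewrite yE ler_peMr// ltW.
have y_gt0 : 0 < y by exact: lt_le_trans y0y.
have e1 : (n%:R + 2 - beta) / 2 = g + 1 by rewrite /g; field.
have e2 : (n%:R + 4) / 2 = b + 1 by rewrite /b; field.
have e3 : (n%:R + 4 - beta) / 2 = g + 2 by rewrite /g; field.
have ey : - 4^-1 * r * delta ^+ 2 = - y by rewrite /y !mulNr.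
have yy0 : y0^-1 * y = r by rewrite yE mulKf ?gt_eqF.
have l2E : - lambda2 mu delta beta (intvec R k) =
    y0^-1 * (mu * (- K * psum (defect_coeff b g) y)).
  rewrite -(hyperg23 b32 gN1) /lambda2 -/r.
  by rewrite e1 e2 e3 ey -yy0; ring.
have l1E : - lambda1 mu lam delta beta (intvec R k) = y0^-1 * (
    mu * (- K * (2 * (psum (bessel_coeff b) y - 1) +
      (1 - 2 * g) * psum (defect_coeff b g) y)) +
    (lam - mu) * (y * psum (mean_coeff b g) y ^+ 2)).
  rewrite -(hyperg34 b32 gN1) -(hyperg12 b32 gN1) /lambda1 -/r.
  by rewrite e1 e2 e3 ey -yy0 -/b; ring.
have yth : 0 <= y `^ th by exact: powR_ge0.
have thr : y `^ th <= y0 `^ th * (1 + r) `^ th.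
  rewrite yE (powRM _ (ltW y00) (ltW r0)) ler_wpM2l ?powR_ge0//.
  by rewrite ge0_ler_powR ?nnegrE//; lra.
have fin (A x : R) : `|x| <= A * y `^ th ->
    y0^-1 * x <= `|D * A| * (1 + r) `^ th.
  move=> xA; have A0 : 0 <= A.
    by rewrite -(pmulr_lge0 _ (powR_gt0 th y_gt0)); exact: le_trans xA.
  have D0 : 0 <= D by rewrite /D mulr_ge0 ?powR_ge0 ?invr_ge0 ?(ltW y00).
  rewrite (ger0_norm (mulr_ge0 D0 A0)).
  rewrite /D -!mulrA ler_pM2l ?invr_gt0// (le_trans (ler_norm _))//.
  rewrite (le_trans xA)//.
  by rewrite [leRHS]mulrCA ler_wpM2l.
have GK : `|- K * psum (defect_coeff b g) y| <= K * CG * y `^ th.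
  by rewrite normrM normrN (ger0_norm K0) -mulrA ler_wpM2l// Gle.
have r1th : 0 <= (1 + r) `^ th by exact: powR_ge0.
split.
  apply: (@le_trans _ _ (`|D * A1| * (1 + r) `^ th)); last first.
    by rewrite ler_wpM2r// lerDl.
  rewrite l1E; apply: fin; rewrite /A1 [leRHS]mulrDl.
  rewrite (le_trans (ler_normD _ _))// lerD//.
    rewrite normrM -[leRHS]mulrA ler_wpM2l// normrM normrN (ger0_norm K0).
    rewrite -[leRHS]mulrA ler_wpM2l//.
    rewrite [leRHS]mulrDl (le_trans (ler_normD _ _))// lerD//.
      rewrite normrM (ger0_norm (_ : 0 <= 2))// -[leRHS]mulrA ler_wpM2l//.
      rewrite (le_trans (ler_normB _ _))// [leRHS]mulrDl lerD ?Ple// normr1.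
      by rewrite -[leLHS](powRr0 y) powR_le_powR.
    by rewrite normrM -[leRHS]mulrA ler_wpM2l// Gle.
  rewrite normrM -[leRHS]mulrA ler_wpM2l// normrM (ger0_norm (ltW y_gt0)).
  rewrite normrX.
  have h : `|psum (mean_coeff b g) y| ^+ 2 <= (CH * y `^ ((th - 1) / 2)) ^+ 2.
    by rewrite lerXn2r ?nnegrE ?Hle// (le_trans _ (Hle _ _)).
  apply: (le_trans (ler_wpM2l (ltW y_gt0) h)).
  rewrite exprMn mulrCA -[(y `^ _) ^+ 2]powR_mulrn ?powR_ge0// -powRrM divfK//.
  rewrite -{1}(@powRr1 _ y (ltW y_gt0)) -powRD ?(gt_eqF y_gt0) ?implybT//.
  by rewrite addrC subrK.
apply: (@le_trans _ _ (`|D * A2| * (1 + r) `^ th)); last first.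
  by rewrite ler_wpM2r// lerDr.
by rewrite l2E; apply: fin; rewrite normrM -[leRHS]mulrA ler_wpM2l.
Qed.

(** * Time profile of a single mode *)

(** The m-th derivative in t of (1 - cos (s t)) / s^2. The value at s = 0 is the
limit as s tends to 0, so that the profile t^2/2 of the mode k = 0 is
covered. *)
Definition profile (R : realType) (s : R) (m : nat) (t : R) : R :=
  match m with
  | 0%N => if s == 0 then t ^+ 2 / 2 else (1 - cos (s * t)) / s ^+ 2
  | 1%N => if s == 0 then t else sin (s * t) / s
  | j.+2 => s ^+ j * cos (s * t + j%:R * (pi / 2))
  end.

Section profile.
Context {R : realType} (s : R).
Hypothesis s0 : 0 <= s.

Lemma is_derive_affine (f df : R -> R) (a t : R) :
  (forall x, is_derive x (1 : R) f (df x)) ->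
  is_derive t (1 : R) (fun x => f (s * x + a)) (s * df (s * t + a)).
Proof.
move=> fd; have Dt := is_derive_id t (1 : R).
have D := is_derive_addf (is_derive_cstM s Dt) (is_derive_cst a t (1 : R)).
have := @is_derive1_comp _ f (fun x => s * x + a) t _ _ (fd _) D.
by rewrite mulr1 addr0 mulrC.
Qed.

Lemma is_derive_profile (m : nat) (t : R) :
  is_derive t (1 : R) (profile s m) (profile s m.+1 t).
Proof.
have Dt := is_derive_id t (1 : R).
have Dcos := is_derive_affine 0 t (@is_derive_cos R).
have Dsin := is_derive_affine 0 t (@is_derive_sin R).
have E (f : R -> R) : (fun x => f (s * x + 0)) = (fun x => f (s * x)).
  by apply/funext => x; rewrite addr0.
rewrite E in Dcos; rewrite E in Dsin; rewrite !addr0 in Dcos, Dsin.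
case: m => [|[|j]].
- have [sE|sn] := eqVneq s 0.
    have D := is_derive_cstM 2^-1 (is_derive_mulf Dt Dt).
    rewrite (_ : profile s 0 = (fun x => 2^-1 * (x * x))); last first.
      by apply/funext => x; rewrite /profile sE eqxx expr2 mulrC.
    by apply: (is_derive_eq D); rewrite /profile sE eqxx; field.
  have D := is_derive_cstM (s ^- 2)
    (is_derive_addf (is_derive_cst (1 : R) t (1 : R)) (is_derive_oppf Dcos)).
  rewrite (_ : profile s 0 = (fun x => s ^- 2 * (1 + - cos (s * x))));
    last first.
    by apply/funext => x; rewrite /profile (negbTE sn) mulrC.
  by apply: (is_derive_eq D); rewrite /profile (negbTE sn); field.
- have [sE|sn] := eqVneq s 0.
    rewrite (_ : profile s 1 = id); last first.
      by apply/funext => x; rewrite /profile sE eqxx.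
    apply: (is_derive_eq Dt).
    by rewrite /profile sE expr0 !mul0r addr0 cos0 mulr1.
  have D := is_derive_cstM s^-1 Dsin.
  rewrite (_ : profile s 1 = (fun x => s^-1 * sin (s * x))); last first.
    by apply/funext => x; rewrite /profile (negbTE sn) mulrC.
  by apply: (is_derive_eq D); rewrite /profile mulKf// expr0 mul1r mul0r addr0.
- have D := is_derive_cstM (s ^+ j)
    (is_derive_affine (j%:R * (pi / 2)) t (@is_derive_cos R)).
  apply: (is_derive_eq D); rewrite /profile.
  rewrite -[j.+1%:R]natr1 [(_ + 1) * _]mulrDl mul1r addrA cosDpihalf.
  by rewrite exprS mulrA (mulrC _ s).
Qed.

(** The truncated subtraction [m - 2] expresses that the profile and its first
derivative are bounded uniformly in s, as iterated primitives of cos (s t). *)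
Lemma profile_le (m : nat) (t : R) : 0 <= t ->
  `|profile s m t| <= (1 + t ^+ 2) * s ^+ (m - 2).
Proof.
have cos1 x : `|cos x : R| <= 1 by rewrite ler_norml cos_geN1 cos_le1.
have p10 : profile s 1 0 = 0 by rewrite /profile mulr0 sin0 mul0r if_same.
have p00 : profile s 0 0 = 0.
  by rewrite /profile mulr0 cos0 subrr expr0n /= !mul0r if_same.
move=> t0; have p1 (x : R) : 0 <= x -> `|profile s 1 x| <= x.
  move=> x0.
  have := @norm_derive_le _ (profile s 1) (profile s 2) id (fun=> 1) 0 x x0.
  rewrite p10 !subr0; apply => // y _.
  - exact: (is_derive_profile 1).
  - by rewrite /profile expr0 mul1r cos1.
have p0 : `|profile s 0 t| <= t ^+ 2 / 2.
  have := @norm_derive_le _ (profile s 0) (profile s 1)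
    (fun x => 2^-1 * (x * x)) id 0 t t0.
  rewrite p00 mulr0 !subr0 mulr0 subr0 mulrC -expr2.
  apply => // y /andP[y0 _].
  - exact: (is_derive_profile 0).
  - have D := is_derive_id y (1 : R).
    by apply: (is_derive_eq (is_derive_cstM 2^-1 (is_derive_mulf D D))); field.
  - exact: p1.
case: m => [|[|j]].
- by rewrite sub0n expr0 mulr1 (le_trans p0)//; have := sqr_ge0 t; lra.
- rewrite (_ : 1 - 2 = 0)%N// expr0 mulr1 (le_trans (p1 _ t0))//.
  by have := sqr_ge0 (t - 1); rewrite !expr2; lra.
- rewrite /= !subSS subn0 normrM normrX (ger0_norm s0) mulrC.
  rewrite ler_wpM2r ?exprn_ge0// (le_trans (cos1 _))//.
  by rewrite lerDl sqr_ge0.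
Qed.

(** The dominating bound for the difference quotients: it involves the same
power of s as the derivative [profile s m.+1] itself. *)
Lemma profile_diffquot_le (m : nat) (t h : R) : 0 <= t -> 0 <= t + h ->
  `|h| <= 1 -> h != 0 ->
  `|h^-1 * (profile s m (t + h) - profile s m t) - profile s m.+1 t| <=
  2 * (1 + (t + 1) ^+ 2) * s ^+ (m.+1 - 2).
Proof.
move=> t0 th0 h1 hn0; set L := (1 + (t + 1) ^+ 2) * s ^+ (m.+1 - 2).
have bnd x : 0 <= x <= t + 1 -> `|profile s m.+1 x| <= L.
  move=> /andP[x0 xt]; rewrite (le_trans (profile_le _ x0))//.
  rewrite ler_wpM2r ?exprn_ge0// lerD2l lerXn2r ?nnegrE//.
  by rewrite addr_ge0.
have lip x y : 0 <= x -> x <= y -> y <= t + 1 ->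
    `|profile s m y - profile s m x| <= L * (y - x).
  move=> x0 xy yt; rewrite mulrBr.
  apply: (@norm_derive_le _ (profile s m) (profile s m.+1) (fun z => L * z)
    (fun=> L)) => // z /andP[xz zy].
  - exact: is_derive_profile.
  - by have := is_derive_cstM L (is_derive_id z (1 : R)); rewrite mulr1.
  - by apply: bnd; rewrite (le_trans x0 xz) (le_trans zy).
move: h1; rewrite ler_norml => /andP[hN1 h1].
have q : `|profile s m (t + h) - profile s m t| <= `|h| * L.
  rewrite mulrC; have [h0|/ltW h0] := leP 0 h.
    have hE : h = t + h - t by ring.
    by rewrite (ger0_norm h0) [X in _ * X]hE lip// ?lerDl ?lerD2l.
  have hE : - h = t - (t + h) by ring.
  by rewrite (ler0_norm h0) hE distrC lip// ?gerDl ?lerDl.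
rewrite -[2 * _ * _]mulrA -/L mulr2n mulrDl !mul1r.
rewrite (le_trans (ler_normB _ _))// lerD//.
  by rewrite normrM normfV ler_pdivrMl ?normr_gt0.
by apply: bnd; rewrite t0 lerDl ler01.
Qed.
End profile.

(** * Norms of the multipliers *)

Lemma sqnorm_tr (R : realType) (n : nat) (v : 'cV[R]_n) :
  sqnorm v = (v^T *m v) 0 0.
Proof. by rewrite mul_tr_self mxE eqxx. Qed.

Lemma sqnormZ (R : realType) (n : nat) (a : R) (v : 'cV[R]_n) :
  sqnorm (a *: v) = a ^+ 2 * sqnorm v.
Proof.
by rewrite /sqnorm mulr_sumr; apply: eq_bigr => i _; rewrite mxE exprMn.
Qed.

Lemma sqnormD_orth (R : realType) (n : nat) (v w : 'cV[R]_n) :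
  v^T *m w = 0 -> sqnorm (v + w) = sqnorm v + sqnorm w.
Proof.
move=> vw; have wv : w^T *m v = 0 by rewrite -[v]trmxK -trmx_mul vw trmx0.
have tD : (v + w)^T = v^T + w^T by apply/matrixP => i j; rewrite !mxE.
rewrite !sqnorm_tr tD mulmxDl !mulmxDr vw wv addr0 add0r.
by rewrite mxE.
Qed.

Lemma lineproj_idem (R : realType) (n : nat) (v w : 'cV[R]_n) :
  lineproj v *m (lineproj v *m w) = lineproj v *m w.
Proof.
have [->|v0] := eqVneq v 0.
  by rewrite /lineproj mul0mx scaler0 !mul0mx.
by rewrite (lineproj_mul v w) -scalemxAr lineproj_self.
Qed.

Lemma lineproj_orthogonal (R : realType) (n : nat) (v w : 'cV[R]_n) :
  (lineproj v *m w)^T *m (w - lineproj v *m w) = 0.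
Proof.
by rewrite trmx_mul lineproj_tr mulmxBr -!mulmxA lineproj_idem subrr.
Qed.

Lemma sqnorm_axial_le (R : realType) (n : nat) (v w : 'cV[R]_n) (a c : R) :
  sqnorm (axial v a c *m w) <= (a ^+ 2 + c ^+ 2) * sqnorm w.
Proof.
have o := lineproj_orthogonal v w; have sp := sqnormD_orth o.
rewrite addrC subrK in sp.
rewrite axial_mul sqnormD_orth; last first.
  have -> (u : 'cV[R]_n) : (a *: u)^T = a *: u^T.
    by apply/matrixP => i j; rewrite !mxE.
  by rewrite -[LHS]scalemxAl -[X in _ *: X]scalemxAr o !scaler0.
rewrite !sqnormZ mulrDl lerD// ler_wpM2l ?sqr_ge0// sp.
  by rewrite lerDl sqnorm_ge0.
by rewrite lerDr sqnorm_ge0.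
Qed.

Lemma sqnormC_split (R : realType) (n : nat) (A : 'M[R]_n) (w : 'cV[R[i]]_n) :
  sqnormC (toC A *m w) =
  sqnorm (A *m map_mx (@complex.Re R) w) +
  sqnorm (A *m map_mx (@complex.Im R) w).
Proof.
rewrite /sqnormC /sqnorm -big_split /=; apply: eq_bigr => i _; rewrite !mxE.
rewrite raddf_sum (raddf_sum (@complex.Im R)) /=.
congr (_ ^+ 2 + _ ^+ 2); apply: eq_bigr => j _; rewrite !mxE.
  by case: (w j 0) => x y /=; rewrite mul0r subr0.
by case: (w j 0) => x y /=; rewrite mul0r addr0.
Qed.

Lemma sqnormC_axial_le (R : realType) (n : nat) (v : 'cV[R]_n) (a c : R)
    (w : 'cV[R[i]]_n) :
  sqnormC (toC (axial v a c) *m w) <= (a ^+ 2 + c ^+ 2) * sqnormC w.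
Proof.
have -> : sqnormC w =
    sqnorm (map_mx (@complex.Re R) w) + sqnorm (map_mx (@complex.Im R) w).
  by rewrite /sqnormC /sqnorm -big_split; apply: eq_bigr => i _; rewrite !mxE.
by rewrite sqnormC_split mulrDr lerD// sqnorm_axial_le.
Qed.

Lemma sqnormC_ge0 (R : realType) (n : nat) (w : 'cV[R[i]]_n) : 0 <= sqnormC w.
Proof. by apply: sumr_ge0 => i _; rewrite addr_ge0 ?sqr_ge0. Qed.

(** * Dominated convergence for sums over the modes *)

Lemma cvge0P (R : realType) (X : Type) (F : set_system X) {FF : Filter F}
    (f : X -> \bar R) :
  (forall x, (0 <= f x)%E) ->
  (forall e : R, 0 < e -> \forall x \near F, (f x <= e%:E)%E) ->
  f x @[x --> F] --> 0%E.
Proof.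
move=> f0 fe; apply/fine_cvgP; split.
  apply: filterS (fe 1 ltr01) => x fx1.
  by rewrite ge0_fin_numE// (le_lt_trans fx1)// ltry.
apply/cvgrPdist_le => e e0; apply: filterS (fe e e0) => x fxe.
rewrite sub0r normrN ger0_norm ?fine_ge0//.
by rewrite -lee_fin fineK// ge0_fin_numE// (le_lt_trans fxe)// ltry.
Qed.

Lemma cvg_sum0 (R : realType) (X T : Type) (F : set_system X) {FF : Filter F}
    (s : seq T) (f : X -> T -> R) :
  (forall k, f x k @[x --> F] --> 0) -> \sum_(k <- s) f x k @[x --> F] --> 0.
Proof.
move=> f0; elim: s => [|k s IH].
  by under eq_fun do rewrite big_nil; exact: cvg_cst.
under eq_fun do rewrite big_cons.
have h : (f x k + \sum_(j <- s) f x j) @[x --> F] --> (0 + 0 : R).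
  exact: cvgD (f0 k) IH.
by rewrite addr0 in h.
Qed.

(** Dominated convergence along an arbitrary filter: outside a finite set the
sum of [a] is at most e/2, and on this finite set convergence is termwise. *)
Lemma esum_dominated_le (R : realType) (X : Type) (T : choiceType)
    (F : set_system X) {FF : Filter F} (f : X -> T -> R) (a : T -> R) :
  (forall x k, 0 <= f x k) -> (forall k, 0 <= a k) ->
  (\forall x \near F, forall k, f x k <= a k) ->
  (forall k, f x k @[x --> F] --> 0) ->
  (\esum_(k in [set: T]) (a k)%:E < +oo)%E ->
  forall e : R, 0 < e ->
  \forall x \near F, (\esum_(k in [set: T]) (f x k)%:E <= e%:E)%E.
Proof.
move=> f0 a0 fa fcvg; set A := (\esum_(k in _) _)%E => Aoo e e0.
have aE0 k : (0 <= (a k)%:E)%E by rewrite lee_fin.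
have A0 : (0 <= A)%E by exact: esum_ge0.
have Afin : A \is a fin_num by rewrite ge0_fin_numE.
have e20 : 0 < e / 2 by rewrite divr_gt0.
have [_ [Y [finY _] <-] AY] := @ub_ereal_sup_adherent _ _ (e / 2) e20 Afin.
have tail : (\esum_(k in [set: T] `&` ~` Y) (a k)%:E <= (e / 2)%:E)%E.
  have := esumID Y setT (fun k => (a k)%:E) (fun k _ => aE0 k).
  rewrite -/A setTI => AE.
  have YE : (\esum_(k in Y) (a k)%:E = \sum_(k \in Y) (a k)%:E)%E.
    by rewrite esum_fset.
  have {}AY : (A - (e / 2)%:E < \sum_(k \in Y) (a k)%:E)%E by [].
  move: AY; rewrite -YE; have := Afin; rewrite AE fin_numD => /andP[].
  move=> /fineK <- /fineK <-; rewrite -EFinB lte_fin lee_fin; lra.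
near=> x.
rewrite (esumID Y)//; last by move=> k _; rewrite lee_fin.
rewrite (splitr e) EFinD leeD//.
  rewrite setTI esum_fset//; last by move=> k _; rewrite lee_fin.
  rewrite fsbig_finite//= sumEFin lee_fin.
  near: x.
  have /cvgrPdist_le/(_ (e / 2) e20) :=
    @cvg_sum0 _ _ _ F FF (finmap.enum_fset (fset_set Y)) f fcvg.
  apply: filterS => x.
  by rewrite sub0r normrN; apply: le_trans; exact: ler_norm.
apply: le_trans tail; apply: le_esum => k _; rewrite lee_fin.
by move: k; near: x.
Unshelve. all: by end_near.
Qed.

(** * Derivatives of the solution *)

Lemma toCB (R : realType) (n : nat) (A B : 'M[R]_n) :
  toC (A - B) = toC A - toC B.
Proof. by apply/matrixP => i j; rewrite !mxE rmorphB. Qed.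

Lemma toCZ (R : realType) (n : nat) (a : R) (A : 'M[R]_n) :
  toC (a *: A) = a%:C *: toC A.
Proof. by apply/matrixP => i j; rewrite !mxE rmorphM. Qed.

Lemma axial_lin (R : realType) (n : nat) (v : 'cV[R]_n)
    (r a a' a'' c c' c'' : R) :
  axial v (r * (a' - a) - a'') (r * (c' - c) - c'') =
  r *: (axial v a' c' - axial v a c) - axial v a'' c''.
Proof. by apply/matrixP => i j; rewrite !mxE; ring. Qed.

Section jets.
Context {R : realType} {n : nat} (b : fourier R n) (s1 s2 : 'cV[int]_n -> R).
Context (S q th A : R) (N : nat).
Local Notation w r k := ((1 + sqnorm (intvec R k)) `^ r).
Hypotheses (s10 : forall k, 0 <= s1 k) (s20 : forall k, 0 <= s2 k).
Hypotheses (s1A : forall k, s1 k ^+ 2 <= A * w th k)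
           (s2A : forall k, s2 k ^+ 2 <= A * w th k).
Hypotheses (A0 : 0 <= A) (th0 : 0 <= th) (qS : q + (N - 2)%:R * th <= S).
Hypothesis hb : Hspace S b.

(** The m-th derivative of the solution, for abstract frequencies [s1] along [k]
and [s2] across [k]. At k = 0 the projection [lineproj 0] is 0, so that only the
profile with frequency [s2 0] acts. *)
Definition jet (m : nat) (t : R) : fourier R n := fun k =>
  toC (axial (intvec R k) (profile (s1 k) m t) (profile (s2 k) m t)) *m b k.

Let w1 (k : 'cV[int]_n) : 1 <= 1 + sqnorm (intvec R k).
Proof. by rewrite lerDl sqnorm_ge0. Qed.

(** The trade of regularity against powers of the frequency; [N - 2] is the
largest power of s that occurs in [N] derivatives. *)
Lemma weight_le (s : 'cV[int]_n -> R) (j : nat) (k : 'cV[int]_n) :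
  (j <= N - 2)%N -> 0 <= s k -> s k ^+ 2 <= A * w th k ->
  w q k * (s k ^+ j) ^+ 2 <= A ^+ j * w S k.
Proof.
move=> jN sk0 skA; have wk := w1 k.
apply: (@le_trans _ _ (w q k * (A * w th k) ^+ j)).
  rewrite ler_wpM2l ?powR_ge0// -exprM mulnC exprM lerXn2r ?nnegrE ?sqr_ge0//.
  by rewrite mulr_ge0 ?powR_ge0.
rewrite exprMn mulrCA ler_wpM2l ?exprn_ge0//.
rewrite -[(_ `^ th) ^+ j]powR_mulrn ?powR_ge0// -powRrM -powRD; last first.
  by rewrite (gt_eqF (lt_le_trans ltr01 wk)) implybT.
rewrite ler_powR// (le_trans _ qS)// lerD2l mulrC ler_wpM2r//.
by rewrite ler_nat.
Qed.

Lemma weighted_axial_le (a c K : R) (j : nat) (k : 'cV[int]_n) :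
  (j <= N - 2)%N ->
  `|a| <= K * s1 k ^+ j -> `|c| <= K * s2 k ^+ j ->
  w q k * sqnormC (toC (axial (intvec R k) a c) *m b k) <=
  (2 * K ^+ 2 * A ^+ j) * (w S k * sqnormC (b k)).
Proof.
move=> jN aK cK.
have sq (x y : R) : `|x| <= y -> x ^+ 2 <= y ^+ 2.
  move=> xy; rewrite -(real_normK (num_real x)) lerXn2r ?nnegrE//.
  exact: le_trans xy.
apply: (le_trans (ler_wpM2l (powR_ge0 _ _) (sqnormC_axial_le _ _ _ _))).
rewrite [leLHS]mulrA [leRHS]mulrA ler_wpM2r ?sqnormC_ge0//.
apply: (@le_trans _ _ (w q k * ((K * s1 k ^+ j) ^+ 2 + (K * s2 k ^+ j) ^+ 2))).
  by rewrite ler_wpM2l ?powR_ge0// lerD// sq.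
have h1 := weight_le jN (s10 k) (s1A k).
have h2 := weight_le jN (s20 k) (s2A k).
have -> : w q k * ((K * s1 k ^+ j) ^+ 2 + (K * s2 k ^+ j) ^+ 2) =
    K ^+ 2 * (w q k * (s1 k ^+ j) ^+ 2 + w q k * (s2 k ^+ j) ^+ 2) by ring.
have -> : 2 * K ^+ 2 * A ^+ j * w S k =
    K ^+ 2 * (A ^+ j * w S k + A ^+ j * w S k) by ring.
by rewrite ler_wpM2l ?sqr_ge0// lerD.
Qed.

Let hbE : (\esum_(k in [set: 'cV[int]_n]) (w S k * sqnormC (b k))%:E < +oo)%E.
Proof. exact: hb. Qed.

Lemma esum_cst_ltoo (c : R) : 0 <= c ->
  (\esum_(k in [set: 'cV[int]_n]) (c * (w S k * sqnormC (b k)))%:E < +oo)%E.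
Proof.
move=> c0.
pose a := (\esum_(k in [set: 'cV[int]_n]) (w S k * sqnormC (b k))%:E)%E.
have afin : a \is a fin_num.
  rewrite ge0_fin_numE ?hbE// esum_ge0// => k _.
  by rewrite lee_fin mulr_ge0 ?powR_ge0 ?sqnormC_ge0.
apply: (@le_lt_trans _ _ (c%:E * a)%E); last first.
  by rewrite -(fineK afin) -EFinM ltry.
apply: ge_ereal_sup => _ [Y [finY _] <-].
under eq_fsbigr do rewrite EFinM.
rewrite -ge0_mule_fsumr; last first.
  by move=> k; rewrite lee_fin mulr_ge0 ?powR_ge0 ?sqnormC_ge0.
rewrite lee_wpmul2l ?lee_fin// /a; apply: ereal_sup_ubound.
by exists Y.
Qed.

Lemma jet_Hspace (m : nat) (t : R) : (m <= N)%N -> 0 <= t -> Hspace q (jet m t).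
Proof.
move=> mN t0; rewrite /Hspace /= /Hsqnorm.
pose K := 1 + t ^+ 2.
have jN : (m - 2 <= N - 2)%N by exact: leq_sub2r.
apply: le_lt_trans (@esum_cst_ltoo (2 * K ^+ 2 * A ^+ (m - 2)) _); last first.
  by rewrite !mulr_ge0 ?exprn_ge0 ?addr_ge0 ?sqr_ge0.
apply: le_esum => k _; rewrite lee_fin; apply: weighted_axial_le => //.
- exact: profile_le.
- exact: profile_le.
Qed.

Lemma jet_Hderiv (m : nat) : (m < N)%N -> Hderiv q (jet m) (jet m.+1).
Proof.
move=> mN t t0.
have jN : (m.+1 - 2 <= N - 2)%N by exact: leq_sub2r.
pose dq s h : R :=
  h^-1 * (profile s m (t + h) - profile s m t) - profile s m.+1 t.
have dE h k : diffquot (jet m) t h k - jet m.+1 t k =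
    toC (axial (intvec R k) (dq (s1 k) h) (dq (s2 k) h)) *m b k.
  rewrite /diffquot /jet /dq axial_lin toCB toCZ toCB mulmxBl; congr (_ - _).
  by rewrite -[RHS]scalemxAl mulmxBl.
have dq0 (s : R) : dq s h @[h --> within [set h | 0 <= t + h] 0^'] --> 0.
  have [Dv De] := is_derive_profile s m t.
  have : dq s h @[h --> 0^'] --> profile s m.+1 t - profile s m.+1 t.
    apply: cvgB; last exact: cvg_cst.
    rewrite -[X in _ --> X]De.
    rewrite (_ : (fun _ => _) = (fun h : R => h^-1 *:
      ((profile s m \o shift t) (h *: (1 : R)) - profile s m t)));
      first exact: Dv.
    apply/funext => h /=.
    have -> : h *: (1 : R) = h by rewrite /GRing.scale /= mulr1.
    by rewrite (addrC h).
  by rewrite subrr => /cvg_within_filter; apply.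
pose K := 2 * (1 + (t + 1) ^+ 2).
pose c := 2 * K ^+ 2 * A ^+ (m.+1 - 2).
have c0 : 0 <= c.
  by rewrite /c /K !mulr_ge0 ?exprn_ge0 ?mulr_ge0 ?addr_ge0 ?sqr_ge0.
apply: cvge0P; first by move=> h; exact: poweR_ge0.
move=> e e0.
have e20 : 0 < e ^+ 2 by rewrite exprn_gt0.
have dom : \forall h \near within [set h | 0 <= t + h] (0 : R)^',
    (Hsqnorm q (fun k => (diffquot (jet m) t h k - jet m.+1 t k)%R) <=
      (e ^+ 2)%:E)%E.
  apply: (@esum_dominated_le _ _ _ _ _
    (fun h k => w q k * sqnormC (diffquot (jet m) t h k - jet m.+1 t k))
    (fun k => c * (w S k * sqnormC (b k)))) => //.
  - by move=> h k; rewrite mulr_ge0 ?powR_ge0 ?sqnormC_ge0.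
  - by move=> k; rewrite (mulr_ge0 c0)// mulr_ge0 ?powR_ge0 ?sqnormC_ge0.
  - rewrite near_withinE; near=> h => th0' k; rewrite dE.
    have h1 : `|h| <= 1 by near: h; exact: dnbhs0_le.
    have hn0 : h != 0 by near: h; exact: nbhs_dnbhs_neq.
    by apply: weighted_axial_le => //; apply: profile_diffquot_le.
  - move=> k.
    apply: (@squeeze_cvgr _ _ _ _ (cst 0) (fun h => w q k *
      ((dq (s1 k) h * dq (s1 k) h + dq (s2 k) h * dq (s2 k) h) *
        sqnormC (b k)))).
    + near=> h; rewrite mulr_ge0 ?powR_ge0 ?sqnormC_ge0//= dE.
      by rewrite ler_wpM2l ?powR_ge0// -!expr2 sqnormC_axial_le.
    + exact: cvg_cst.
    + rewrite [X in _ --> X](_ : 0 =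
        w q k * ((0 * 0 + 0 * 0) * sqnormC (b k))); last by ring.
      by apply: cvgMr; apply: cvgMl; apply: cvgD; apply: cvgM.
  - exact: esum_cst_ltoo.
apply: filterS dom => h he; rewrite /Hnorm.
have -> : e%:E = ((e ^+ 2)%:E `^ (2^-1))%E.
  by rewrite poweR_EFin -powR_mulrn ?ltW// -powRrM divff ?powRr1 ?ltW.
apply: gt0_ler_poweR;
  rewrite ?in_itv/= ?leey ?andbT ?lee_fin ?invr_ge0 ?sqr_ge0//.
by apply: esum_ge0 => k _; rewrite lee_fin mulr_ge0 ?powR_ge0 ?sqnormC_ge0.
Unshelve. all: by end_near.
Qed.

Lemma jet_Cp (p m : nat) : (m + p <= N)%N -> Cp q p (jet m).
Proof.
elim: p m => [|p IH] m mpN /=.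
  by split=> // t t0; apply: jet_Hspace => //; rewrite addn0 in mpN.
split=> [t t0|].
  by apply: jet_Hspace => //; apply: leq_trans mpN; exact: leq_addr.
exists (jet m.+1); split; last by apply: IH; rewrite addSnnS.
by apply: jet_Hderiv; apply: leq_trans mpN; rewrite -addSnnS leq_addr.
Qed.
End jets.

(** * The solution operator *)

Lemma axial_mulmx (R : realType) (n : nat) (v : 'cV[R]_n) (a c a' c' : R) :
  v != 0 ->
  axial v a c *m axial v a' c' = axial v (a * a') (c * c').
Proof.
move=> v0; apply/(axialP _ _ _ v0).
have [Av Aw] := (axialP a c (axial v a c) v0).1 erefl.
have [Bv Bw] := (axialP a' c' (axial v a' c') v0).1 erefl.
split=> [|w vw]; rewrite -mulmxA.
  by rewrite Bv -scalemxAr Av scalerA mulrC.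
by rewrite (Bw _ vw) -scalemxAr (Aw _ vw) scalerA mulrC.
Qed.

Lemma axial1 (R : realType) (n : nat) (v : 'cV[R]_n) : axial v 1 1 = 1%:M.
Proof. by rewrite /axial !scale1r addrC subrK. Qed.

Lemma invmx_axial (R : realType) (n : nat) (v : 'cV[R]_n) (a c : R) :
  v != 0 -> a != 0 -> c != 0 -> invmx (axial v a c) = axial v a^-1 c^-1.
Proof.
move=> v0 a0 c0.
have AB : axial v a c *m axial v a^-1 c^-1 = 1%:M.
  by rewrite axial_mulmx// !divff// axial1.
have [uA _] := mulmx1_unit AB.
by rewrite -[LHS]mulmx1 -AB mulmxA mulVmx// mul1mx.
Qed.

(** Negativity of the multipliers away from 0 makes [Mk] invertible and - [Mk]
the square of its square root. At k = 0 the frequencies vanish, and the profile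
t^2/2 is the one of the zero mode. *)
Lemma Usol_jet (R : realType) (n : nat) (mu lam delta beta : R)
    (b : fourier R n) :
  (forall nu : 'cV[R]_n, nu != 0 -> lambda1 mu lam delta beta nu < 0) ->
  (forall nu : 'cV[R]_n, nu != 0 -> lambda2 mu delta beta nu < 0) ->
  Usol mu lam delta beta b =
  jet b (fun k => Num.sqrt (- lambda1 mu lam delta beta (intvec R k)))
        (fun k => Num.sqrt (- lambda2 mu delta beta (intvec R k))) 0.
Proof.
move=> l1 l2; apply/funext => t; apply/funext => k; rewrite /Usol /jet.
case: eqP => [->|/eqP k0].
  have v0 : intvec R (0 : 'cV[int]_n) = 0 by apply/eqP; rewrite intvec_eq0.
  have s0 : sqnorm (0 : 'cV[R]_n) = 0 by apply/eqP; rewrite sqnorm_eq0.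
  have P0 : lineproj (0 : 'cV[R]_n) = 0 by rewrite /lineproj mul0mx scaler0.
  rewrite v0 /axial P0 scaler0 add0r subr0 /lambda2 s0 mulr0 mul0r oppr0 sqrtr0.
  by rewrite /profile eqxx toCZ /toC map_mx1 -scalemxAl mul1mx.
have v0 : intvec R k != 0 by rewrite intvec_eq0.
have {}l1 := l1 _ v0; have {}l2 := l2 _ v0.
have pE (l : R) : l < 0 -> (cos (Num.sqrt (- l) * t) - 1) * l^-1 =
    profile (Num.sqrt (- l)) 0 t.
  move=> l0; rewrite /profile sqrtr_eq0 oppr_le0 leNgt l0 /=.
  rewrite sqr_sqrtr ?oppr_ge0 ?ltW//.
  by rewrite invrN mulrN -mulNr opprB.
congr (toC _ *m _); rewrite /Mk invmx_axial ?lt_eqF//.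
rewrite -!pE// -axial_mulmx//; congr (_ *m _).
rewrite -(axial1 (intvec R k)) /cos_sqrtNMk /fMk /axial.
by apply/matrixP => i j; rewrite !mxE; ring.
Qed.

(** The three regimes of the theorem are three choices of [th]; the hypotheses
on [th] are those of [lambda_growth]. *)
Lemma Usol_Cp (R : realType) (n : nat) (mu lam delta beta S q th : R) (N : nat)
    (b : fourier R n) :
  (0 < n)%N -> 0 < delta -> beta < n%:R + 2 ->
  (forall nu : 'cV[R]_n, nu != 0 -> lambda1 mu lam delta beta nu < 0) ->
  (forall nu : 'cV[R]_n, nu != 0 -> lambda2 mu delta beta nu < 0) ->
  Hspace S b ->
  0 <= th -> 0 <= th + (n%:R - beta) / 2 -> (beta = n%:R -> 0 < th) ->
  q + (N - 2)%:R * th <= S ->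
  Cp q N (Usol mu lam delta beta b).
Proof.
move=> n0 delta0 betan l1 l2 hb th0 thg betath qS.
have [A A0 Ale] :=
  @lambda_growth R n mu lam delta beta th n0 delta0 betan th0 thg betath.
rewrite Usol_jet//.
have sqrt_le (l B : R) : 0 <= B -> - l <= B -> Num.sqrt (- l) ^+ 2 <= B.
  move=> B0 lB; have [l0|/ltW l0] := leP 0 (- l); first by rewrite sqr_sqrtr.
  by rewrite ler0_sqrtr// expr0n.
have AW (k : 'cV[int]_n) : 0 <= A * (1 + sqnorm (intvec R k)) `^ th.
  by rewrite mulr_ge0 ?powR_ge0.
apply: (@jet_Cp _ _ _ _ _ S q th A N) => //.
- by move=> k; apply: sqrt_le => //; case: (Ale k).
- by move=> k; apply: sqrt_le => //; case: (Ale k).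
Qed.

Theorem theorem26 (R : realType) (n : nat) (mu lam delta beta S : R)
    (b : fourier R n)
    (hn : (0 < n)%N) (hdelta : 0 < delta) (hbeta : beta < n%:R + 2)
    (hmu : 0 < mu)
    (hlambda1 : forall nu : 'cV[R]_n, nu != 0 ->
       lambda1 mu lam delta beta nu < 0)
    (hlambda2 : forall nu : 'cV[R]_n, nu != 0 ->
       lambda2 mu delta beta nu < 0)
    (hb : Hspace S b) :
  let U := Usol mu lam delta beta b in
  [/\ beta < n%:R -> forall q : R, q <= S -> Cinfty q U,
      beta = n%:R -> forall q : R, q < S -> Cinfty q U
    & n%:R < beta -> forall (q : R) (p : nat), (0 < p)%N ->
        q - S + (p%:R - 1) * ((beta - n%:R) / 2) <= 0 -> Cp q p.+1 U].
Proof.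
move=> U; split=> [bn q qS N|bn q qS N|bn q p p0 qS].
- by apply: (@Usol_Cp _ _ _ _ _ _ S q 0) => //; [lra|lra|rewrite mulr0 addr0].
- (* The gap S - q is spread over the derivatives; N.+1 avoids dividing by 0. *)
  pose th := (S - q) / N.+1%:R.
  have th0 : 0 < th by rewrite divr_gt0// subr_gt0.
  apply: (@Usol_Cp _ _ _ _ _ _ S q th) => //; rewrite ?(ltW th0)//.
    by rewrite bn subrr mul0r addr0 ltW.
  have : (N - 2)%:R * th <= N.+1%:R * th.
    by rewrite ler_wpM2r ?(ltW th0)// ler_nat (leq_trans (leq_subr _ _)).
  by rewrite [X in _ <= X]mulrC divfK ?pnatr_eq0//; lra.
- apply: (@Usol_Cp _ _ _ _ _ _ S q ((beta - n%:R) / 2)) => //; [lra|lra|lra|].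
  by rewrite subSS natrB//; lra.
Qed.
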